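(* Let $f$ be a unipotent multivalued function on $\mathcal M_{0,n+3}(\mathbb C)\subset\overline{\mathcal M}_{0,n+3}(\mathbb C)$, let $(q,t_1,\dots,t_n)\in\mathcal S$, and fix a branch of $f$ near $(t_1,\dots,t_n)$. Suppose that the chosen branch of $f$ vanishes along every divisor $D_I$ of type $0$ (for $\emptyset\ne I\subseteq\{1,\dots,n\}$) with multiplicity $|I|$. Then the series $$\sum_{m_1,\dots,m_n\in\mathbb Z}u_1^{m_1}\cdots u_n^{m_n}\,f(q^{m_1}t_1,\dots,q^{m_n}t_n)$$ converges absolutely on compacta of the region $1<|u_1|,\dots,|u_n|<|q|^{-1}$.
   Context: $\mathcal M_{0,n+3}(\mathbb C)=\{(t_1,\dots,t_n)\in(\mathbb C\setminus\{0,1\})^n: t_i\ne t_j \text{ for } i\neq j\}$ is the moduli space of genus $0$ curves with marked points $0,1,\infty,t_1,\dots,t_n$, and $\overline{\mathcal M}_{0,n+3}$ is its standard smooth compactification with simple normal crossing boundary. The boundary divisors are indexed by partitions $S|T$ of the set of marked points with $|S|,|T|\ge2$. For nonempty $I\subseteq\{1,\dots,n\}$, $D_I$ (type $0$) is the divisor $\{0,t_k:k\in I\}\,|\,\{\infty,1,t_k:k\notin I\}$. Unipotent: a multivalued holomorphic function $f$ on $X\setminus D$ ($X$ smooth projective, $D$ simple normal crossing) is unipotent if on every simply connected open $V\subset X$ with local coordinates $z_1,\dots,z_n$ such that $V\cap D=\bigcup_{i=1}^k\{z_i=0\}$ it admits a finite expansion $f=\sum_{I=(i_1,\dots,i_k)}\log^{i_1}(z_1)\cdots\log^{i_k}(z_k)f_I(z_1,\dots,z_n)$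 with $f_I$ holomorphic on $V$. A branch vanishes along $D_I=\{z_j=0\}$ with multiplicity $M$ if all coefficients $f_I$ of its local expansion are divisible by $z_j^M$. $\mathcal S=\{(q,t_1,\dots,t_n):0<|q|<|t_1|<\dots<|t_n|<1,\ t_it_j^{-1}\notin q^{\mathbb R}\ (i\ne j),\ t_i\notin q^{\mathbb R}\}$, where $q=\exp(2\pi i\tau)$, $\mathrm{Im}\,\tau>0$, and $q^s=\exp(2\pi i\tau s)$. A branch of $f$ near $(t_1,\dots,t_n)$ continues uniquely along the simply connected image of $\mathbb R^n\ni(s_1,\dots,s_n)\mapsto(q^{s_1}t_1,\dots,q^{s_n}t_n)$; this defines the values $f(q^{m_1}t_1,\dots,q^{m_n}t_n)$ for $m_i\in\mathbb Z$ and the ''chosen branch'' in each region near the boundary. *)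

(* Defs.v *)
From HB Require Import structures.
From mathcomp Require Import all_boot all_order all_algebra.
From mathcomp Require Import complex.
From mathcomp Require Import all_classical all_reals all_analysis.

Set Implicit Arguments.
Unset Strict Implicit.
Unset Printing Implicit Defensive.

Import Order.TTheory GRing.Theory Num.Theory.
Import numFieldNormedType.Exports.

Local Open Scope classical_set_scope.
Local Open Scope ring_scope.

(* The usual topology of the complex numbers; [differentiable] at type
   ['rV[R[i]]_n -> R[i]] then means complex-differentiable. *)
HB.instance Definition _ (R : realType) := NormedModule.copy R[i] R[i]^o.

(* [`|z|] lives in [R[i]]; this is the same number in [R]. *)
Definition cabs (R : realType) (z : R[i]) : R := complex.Re `|z|.

Definition cexp (R : realType) (z : R[i]) : R[i] :=
  ((expR (complex.Re z) * cos (complex.Im z))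
    +i* (expR (complex.Re z) * sin (complex.Im z)))%C.

(* q^s = exp(2 pi i tau s), so that q itself is [qpow tau 1]. *)
Definition qpow (R : realType) (tau : R[i]) (s : R) : R[i] :=
  cexp ((0 +i* (2 * pi))%C * tau * (s +i* 0)%C).

Definition holomorphic_on (R : realType) (n : nat) (U : set 'rV[R[i]]_n)
    (g : 'rV[R[i]]_n -> R[i]) : Prop :=
  forall z, U z -> differentiable g z.

Definition polydisc (R : realType) (n : nat) (r : 'I_n -> R) :
    set 'rV[R[i]]_n :=
  [set z | forall i, cabs (z ord0 i) < r i].

Definition M0n (R : realType) (n : nat) : set 'rV[R[i]]_n :=
  [set t | (forall i, t ord0 i != 0 /\ t ord0 i != 1) /\
           (forall i j, i != j -> t ord0 i != t ord0 j)].
Arguments M0n : clear implicits.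

(* The compactification is realised as the closure of the image of M_{0,n+3}
   in a product of projective lines under all the cross-ratios (equivalently,
   under all forgetful maps to the compactified M_{0,4} = P^1); this is a
   closed embedding onto a smooth subvariety. *)

Definition P1 (R : realType) : Type := one_point_compactification R[i].
HB.instance Definition _ (R : realType) := Topological.on (P1 R).

(* The point [a : b]; only meaningful when (a, b) <> (0, 0). *)
Definition P1_of (R : realType) (a b : R[i]) : P1 R :=
  if b == 0 then None else Some (a / b).

Inductive mark (n : nat) : Type :=
  | Mark0 | Mark1 | MarkInf | MarkT of 'I_n.

Definition mark_code (n : nat) (a : mark n) : option (option (option 'I_n)) :=
  match a with
  | Mark0 => None
  | Mark1 => Some None
  | MarkInf => Some (Some None)
  | MarkT i => Some (Some (Some i))
  end.

Definition mark_decode (n : nat) (x : option (option (option 'I_n))) : mark n :=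
  match x with
  | None => Mark0 n
  | Some None => Mark1 n
  | Some (Some None) => MarkInf n
  | Some (Some (Some i)) => MarkT i
  end.

Lemma mark_codeK (n : nat) : cancel (@mark_code n) (@mark_decode n).
Proof. by case. Qed.

HB.instance Definition _ (n : nat) :=
  Finite.copy (mark n) (can_type (@mark_codeK n)).

Definition mark_coord (R : realType) (n : nat) (t : 'rV[R[i]]_n)
    (a : mark n) : R[i] * R[i] :=
  match a with
  | Mark0 => (0, 1)
  | Mark1 => (1, 1)
  | MarkInf => (1, 0)
  | MarkT i => (t ord0 i, 1)
  end.

Definition bracket (R : realType) (x y : R[i] * R[i]) : R[i] :=
  x.1 * y.2 - y.1 * x.2.

Definition quad (n : nat) : finType := (mark n * mark n * mark n * mark n)%type.

Definition ambient (R : realType) (n : nat) : topologicalType :=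
  {ptws quad n -> P1 R}.

(* ((a - c)(b - d)) / ((a - d)(b - c)): the cross-ratio equal to 1 when a and b
   (or c and d) collide.  A quadruple with a repeated mark contributes a
   constant coordinate. *)
Definition cross_ratio (R : realType) (n : nat) (t : 'rV[R[i]]_n) :
    ambient R n :=
  fun abcd : quad n =>
    let: (a, b, c, d) := abcd in
    let p := mark_coord t in
    P1_of (bracket (p a) (p c) * bracket (p b) (p d))
          (bracket (p a) (p d) * bracket (p b) (p c)).

Definition Mbar (R : realType) (n : nat) : set (ambient R n) :=
  closure (@cross_ratio R n @` M0n R n).
Arguments Mbar : clear implicits.

Definition boundary (R : realType) (n : nat) : set (ambient R n) :=
  Mbar R n `\` (@cross_ratio R n @` M0n R n).
Arguments boundary : clear implicits.

(* The divisor S | S^c.  A stable curve has a node separating S from its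
   complement iff every four-pointed curve a, b, c, d obtained from it, with
   a, b in S and c, d outside S, degenerates with a, b on one side and c, d on
   the other, i.e. has cross-ratio 1. *)
Definition boundary_divisor (R : realType) (n : nat) (S : set (mark n)) :
    set (ambient R n) :=
  [set x | Mbar R n x /\
    forall a b c d, S a -> S b -> ~ S c -> ~ S d ->
      x (a, b, c, d) = Some 1].
Arguments boundary_divisor R {n} S _ : rename.

Definition divisor_type0 (R : realType) (n : nat) (I : {set 'I_n}) :
    set (ambient R n) :=
  boundary_divisor R
    [set a : mark n | a = Mark0 n \/ exists2 k, k \in I & a = MarkT k].
Arguments divisor_type0 R {n} I _ : rename.

(* Locally a quotient of two holomorphic functions without common zeros. *)
Definition holomorphic_P1 (R : realType) (n : nat) (U : set 'rV[R[i]]_n)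
    (g : 'rV[R[i]]_n -> P1 R) : Prop :=
  forall z, U z -> exists a b : 'rV[R[i]]_n -> R[i],
    \forall w \near z,
      [/\ differentiable a w, differentiable b w,
          (a w != 0) || (b w != 0) & g w = P1_of (a w) (b w)].

(* [phi] is the inverse of a system of local coordinates z_1, ..., z_n on the
   open subset V := phi (polydisc r) of [Mbar], in which the boundary is given
   by z_1 ... z_k = 0.  (An injective holomorphic map between complex manifolds
   of the same dimension is biholomorphic onto its image.)  The coordinate
   domains are polydiscs: for an arbitrary simply connected V, {z_i = 0} could
   be a union of pieces of several boundary divisors, and even log t_1 would
   fail to have an expansion of the required form. *)
Definition chart (R : realType) (n k : nat) (r : 'I_n -> R)
    (phi : 'rV[R[i]]_n -> ambient R n) : Prop :=
  [/\ (k <= n)%N /\ (forall i, 0 < r i),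
      forall abcd : quad n, holomorphic_P1 (polydisc r) (fun z => phi z abcd),
      forall z z', polydisc r z -> polydisc r z' -> phi z = phi z' -> z = z',
      exists2 O : set (ambient R n), open O &
        phi @` polydisc r = Mbar R n `&` O
    & forall z, polydisc r z ->
        (boundary R n (phi z) <-> exists2 i : 'I_n, (i < k)%N & z ord0 i = 0)].

Definition covering_map (R : realType) (n : nat) (M : set 'rV[R[i]]_n)
    (Y : topologicalType) (p : Y -> 'rV[R[i]]_n) : Prop :=
  [/\ continuous p, range p = M
    & forall x, M x -> exists (U : set 'rV[R[i]]_n) (J : Type)
        (s : J -> 'rV[R[i]]_n -> Y),
      [/\ open_nbhs x U, U `<=` M,
          forall j, {within U, continuous (s j)} /\ open (s j @` U),
          forall j z, U z -> p (s j z) = z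
        & forall y, U (p y) -> exists! j, s j (p y) = y]].

(* A multivalued holomorphic function on M is a holomorphic function on a
   connected covering space of M; a branch over U is its composition with a
   continuous section over U. *)
Record multivalued (R : realType) (n : nat) (M : set 'rV[R[i]]_n) :=
  Multivalued {
    mv_space : topologicalType;
    mv_proj : mv_space -> 'rV[R[i]]_n;
    mv_val : mv_space -> R[i];
    mv_covering : covering_map M mv_proj;
    mv_connected : connected [set: mv_space];
    mv_holomorphic : forall (U : set 'rV[R[i]]_n) (s : 'rV[R[i]]_n -> mv_space),
      open U -> {within U, continuous s} ->
      (forall z, U z -> mv_proj (s z) = z) ->
      holomorphic_on U (fun z => mv_val (s z))
  }.

(* Coordinates (log z_1, ..., log z_k, z_{k+1}, ..., z_n), which uniformise the
   universal cover [log_domain] of {z in polydisc r | z_1 ... z_k <> 0}. *)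
Definition from_log (R : realType) (n k : nat) (w : 'rV[R[i]]_n) :
    'rV[R[i]]_n :=
  \row_i (if (i < k)%N then cexp (w ord0 i) else w ord0 i).

Definition log_domain (R : realType) (n k : nat) (r : 'I_n -> R) :
    set 'rV[R[i]]_n :=
  @from_log R n k @^-1` polydisc r.
Arguments log_domain {R n} k r _ : rename.

(* A branch on V \ D of a multivalued function: a lift of V \ D, pulled back to
   its universal cover. *)
Definition branch_at (R : realType) (n : nat) (f : multivalued (M0n R n))
    (k : nat) (r : 'I_n -> R) (phi : 'rV[R[i]]_n -> ambient R n)
    (ell : 'rV[R[i]]_n -> mv_space f) : Prop :=
  {within log_domain k r, continuous ell} /\
  forall w, log_domain k r w ->
    cross_ratio (mv_proj (ell w)) = phi (from_log k w).

(* The multi-indices (i_1, ..., i_k) with entries at most N, extended by 0. *)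
Definition log_exponent (n k N : nat) (J : {ffun 'I_n -> 'I_N.+1}) : bool :=
  [forall i : 'I_n, (k <= i)%N ==> (J i == ord0)].

Definition log_expansion (R : realType) (n : nat) (f : multivalued (M0n R n))
    (k : nat) (r : 'I_n -> R) (ell : 'rV[R[i]]_n -> mv_space f) (N : nat)
    (c : {ffun 'I_n -> 'I_N.+1} -> 'rV[R[i]]_n -> R[i]) : Prop :=
  (forall J, log_exponent k J -> holomorphic_on (polydisc r) (c J)) /\
  forall w, log_domain k r w ->
    mv_val (ell w) =
      \sum_(J : {ffun 'I_n -> 'I_N.+1} | log_exponent k J)
        (\prod_(i < n) w ord0 i ^+ J i) * c J (from_log k w).

Definition unipotent (R : realType) (n : nat) (f : multivalued (M0n R n)) :
    Prop :=
  forall (k : nat) (r : 'I_n -> R) (phi : 'rV[R[i]]_n -> ambient R n)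
      (ell : 'rV[R[i]]_n -> mv_space f),
    chart k r phi -> branch_at k r phi ell ->
    exists (N : nat) (c : {ffun 'I_n -> 'I_N.+1} -> 'rV[R[i]]_n -> R[i]),
      log_expansion k r ell c.

Definition in_calS (R : realType) (n : nat) (tau : R[i]) (t : 'rV[R[i]]_n) :
    Prop :=
  [/\ 0 < complex.Im tau,
      forall i, cabs (qpow tau 1) < cabs (t ord0 i) < 1,
      forall i j : 'I_n, (i < j)%N -> cabs (t ord0 i) < cabs (t ord0 j),
      forall i j s, i != j -> t ord0 i / t ord0 j != qpow tau s
    & forall i s, t ord0 i != qpow tau s].

Definition qtranslate (R : realType) (n : nat) (tau : R[i])
    (t : 'rV[R[i]]_n) (s : 'rV[R]_n) : 'rV[R[i]]_n :=
  \row_i (qpow tau (s ord0 i) * t ord0 i).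

(* [sigma] is the continuation, along (s_1, ..., s_n) |-> (q^{s_i} t_i)_i, of
   the branch of f near t given by the point [y0] over t. *)
Definition continuation (R : realType) (n : nat) (f : multivalued (M0n R n))
    (tau : R[i]) (t : 'rV[R[i]]_n) (y0 : mv_space f)
    (sigma : 'rV[R]_n -> mv_space f) : Prop :=
  [/\ continuous sigma, sigma 0 = y0
    & forall s, mv_proj (sigma s) = qtranslate tau t s].

(* The branch [ell] near the centre phi(0) is the chosen one: it agrees with
   the continuation [sigma] at points arbitrarily close to phi(0). *)
Definition chosen_branch (R : realType) (n : nat) (f : multivalued (M0n R n))
    (sigma : 'rV[R]_n -> mv_space f) (k : nat) (r : 'I_n -> R)
    (ell : 'rV[R[i]]_n -> mv_space f) : Prop :=
  forall e : R, 0 < e -> exists (s : 'rV[R]_n) (w : 'rV[R[i]]_n),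
    [/\ log_domain k r w, polydisc (fun=> e) (from_log k w)
      & ell w = sigma s].

Definition vanishes_along (R : realType) (n : nat) (f : multivalued (M0n R n))
    (sigma : 'rV[R]_n -> mv_space f) (E : set (ambient R n)) (M : nat) : Prop :=
  forall (k : nat) (r : 'I_n -> R) (phi : 'rV[R[i]]_n -> ambient R n)
      (ell : 'rV[R[i]]_n -> mv_space f) (j : 'I_n),
    chart k r phi -> branch_at k r phi ell -> chosen_branch sigma k r ell ->
    (forall z, polydisc r z -> (E (phi z) <-> z ord0 j = 0)) ->
    forall (N : nat) (c : {ffun 'I_n -> 'I_N.+1} -> 'rV[R[i]]_n -> R[i]),
      log_expansion k r ell c ->
      forall J, log_exponent k J ->
        exists2 g : 'rV[R[i]]_n -> R[i], holomorphic_on (polydisc r) g &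
          forall z, polydisc r z -> c J z = z ord0 j ^+ M * g z.

Definition annuli (R : realType) (n : nat) (tau : R[i]) : set 'rV[R[i]]_n :=
  [set u | forall i, 1 < cabs (u ord0 i) < (cabs (qpow tau 1))^-1].
Arguments annuli {R} n tau _ : rename.

(* Normal convergence: on every compact subset of [A] the series of absolute
   values is dominated by a convergent series of constants. *)
Definition converges_absolutely_on_compacta (R : realType) (n : nat)
    (I : choiceType) (A : set 'rV[R[i]]_n) (a : I -> 'rV[R[i]]_n -> R[i]) :
    Prop :=
  forall K : set 'rV[R[i]]_n, compact K -> K `<=` A ->
    exists2 B : I -> R, summable [set: I] (fun m => (B m)%:E) &
      forall u m, K u -> cabs (a m u) <= B m.

(* Main.v *)
(** The moduli |q^(m_i) t_i|, for integers m_i, are pairwise distinct and different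
    from 1, with a gap uniform in m.  So every point of the series lies in one of
    finitely many polydiscs |z_j| <= rho < 1, one for each linear order on
    {1, t_1, ..., t_n}: the coordinates are the quotients z_j of consecutive points
    (1 included), they extend to a chart of the compactification around a maximally
    degenerate curve, a chain of projective lines, and the divisors of type 0 are
    the z_j = 0 for which z_j is a quotient of points not beyond 1.  The continued
    branch lifts to this chart, because the region of the s_i realising a given
    order is convex.  Since D_I is z_j = 0 with |I| = j, the coefficients of the
    logarithmic expansion are bounded by a constant times the product of the
    |z_j|^j, which is the product of the moduli less than 1; combining the
    divisibilities along the various divisors uses only the maximum principle in one
    variable, which is proved from Goursat's theorem in logarithmic polar
    coordinates.  Hence f(q^m t) is O of a polynomial in m times the product of the
    |q|^(m_i) over m_i >= 0, and the series is dominated by a product of geometric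
    ones. *)
Require Import Defs.
From HB Require Import structures.
From mathcomp Require Import all_boot all_order all_algebra.
From mathcomp Require Import complex.
From mathcomp Require Import all_classical all_reals all_analysis.
From mathcomp Require Import ring lra zify.

Set Implicit Arguments.
Unset Strict Implicit.
Unset Printing Implicit Defensive.

Import Order.TTheory GRing.Theory Num.Theory.
Import numFieldNormedType.Exports.

Local Open Scope classical_set_scope.
Local Open Scope ring_scope.

(** * Complex numbers *)

Section ComplexModulus.
Variable R : realType.
Implicit Types (x y z w : R[i]) (e : R).

(** Everything has to be uniform in m. For the constants, all points sharing an order must lie in
    one fixed compact part of one chart; this is why the charts are explicit, with the whole open
    unit polydisc as domain, instead of unspecified small neighbourhoods of boundary points. For the
    branch, the complement of the boundary in such a polydisc becomes, in logarithmic coordinates, a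
    product of left half-planes, on which s acts by affine formulas; a single lift then serves every
    m of that order, and the powers of logarithms in the expansion are polynomial in m. The
    divisibility hypotheses come one divisor at a time, each with its own quotient, whereas the
    estimate needs all the factors at once: this gap is what calls for complex analysis. The bounds
    on |u| reflect the decay obtained: for m_i >= 0 the factor |q|^(m_i) compensates |u_i| < 1/|q|,
    and for m_i < 0 convergence comes from |u_i| > 1 alone. *)

Lemma normcE_cabs z : `|z| = (cabs z)%:C%C.
Proof. by rewrite /cabs; case: z. Qed.

Lemma cabsE z : cabs z = Normc.normc z.
Proof. by rewrite /cabs; case: z. Qed.

Lemma cabs_ge0 z : 0 <= cabs z.
Proof. by rewrite cabsE; case: z => a b; rewrite /= sqrtr_ge0. Qed.

Lemma cabs_gt0 z : (0 < cabs z) = (z != 0).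
Proof. by rewrite -ltcR -normcE_cabs normr_gt0. Qed.

Lemma cabs0 : cabs (0 : R[i]) = 0.
Proof. by rewrite /cabs normr0. Qed.

Lemma cabs1 : cabs (1 : R[i]) = 1.
Proof. by rewrite /cabs normr1. Qed.

Lemma cabsM x y : cabs (x * y) = cabs x * cabs y.
Proof. by apply: complexI; rewrite rmorphM/= -!normcE_cabs normrM. Qed.

Lemma cabsV x : cabs x^-1 = (cabs x)^-1.
Proof. by apply: complexI; rewrite fmorphV/= -!normcE_cabs normfV. Qed.

Lemma cabsN x : cabs (- x) = cabs x.
Proof. by rewrite /cabs normrN. Qed.

Lemma cabs_distC x y : cabs (x - y) = cabs (y - x).
Proof. by rewrite /cabs distrC. Qed.

Lemma ler_cabsD x y : cabs (x + y) <= cabs x + cabs y.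
Proof. by rewrite -lecR rmorphD/= -!normcE_cabs ler_normD. Qed.

Lemma ler_cabsB x y : cabs x - cabs y <= cabs (x - y).
Proof. by rewrite lerBlDr; have := ler_cabsD (x - y) y; rewrite subrK. Qed.

Lemma cabsX x n : cabs (x ^+ n) = cabs x ^+ n.
Proof. by elim: n => [|n IH]; rewrite ?cabs1// !exprS cabsM IH. Qed.

Lemma cabs_exprz x (m : int) : cabs (x ^ m) = cabs x ^ m.
Proof. by case: m => n; rewrite ?NegzE -?exprnP -?exprnN ?cabsV cabsX. Qed.

Lemma cabs_prod (I : Type) (s : seq I) (P : pred I) (F : I -> R[i]) :
  cabs (\prod_(i <- s | P i) F i) = \prod_(i <- s | P i) cabs (F i).
Proof. exact: (big_morph (@cabs R) cabsM cabs1). Qed.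

Lemma ler_cabs_sum (I : Type) (s : seq I) (P : pred I) (F : I -> R[i]) :
  cabs (\sum_(i <- s | P i) F i) <= \sum_(i <- s | P i) cabs (F i).
Proof.
apply: (big_ind2 (fun a b => cabs a <= b)); rewrite ?cabs0//.
by move=> a b c d ab cd; apply: le_trans (ler_cabsD _ _) (lerD ab cd).
Qed.

Lemma ler_Re_cabs z : `|complex.Re z| <= cabs z.
Proof. by rewrite -lecR -normcE_cabs normc_ge_Re. Qed.

Lemma ler_Im_cabs z : `|complex.Im z| <= cabs z.
Proof.
have := ler_Re_cabs (z * 'i%C); rewrite ReiNIm normrN cabsM.
by rewrite [cabs 'i%C]cabsE /= expr0n/= add0r expr1n sqrtr1 mulr1.
Qed.

Lemma ler_cabs_ReIm z : cabs z <= `|complex.Re z| + `|complex.Im z|.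
Proof.
rewrite [in leLHS](complexE z); apply: le_trans (ler_cabsD _ _) _.
rewrite cabsM !cabsE /= !expr0n/= add0r addr0 expr1n !sqrtr1 mul1r.
by rewrite !addr0 !sqrtr_sqr.
Qed.

Lemma cabs_real e : cabs (e%:C%C) = `|e|.
Proof. by rewrite cabsE/= expr0n addr0 sqrtr_sqr. Qed.

(** Balls of [R[i]] have radii in [R[i]]; a positive complex number is real, so real radii give the
    same neighbourhoods. *)
Lemma nbhs_cabsP z (A : set R[i]) :
  nbhs z A <-> exists2 e, 0 < e & forall y, cabs (y - z) < e -> A y.
Proof.
split=> [/nbhs_ballP[e /= e0 eA]|[e e0 eA]].
  move: e0; rewrite ltcE /= => /andP[/eqP Ie e0].
  have eE : e = (complex.Re e)%:C%C by case: e Ie {e0 eA} => a b /= ->.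
  exists (complex.Re e) => // y yz; apply: eA; rewrite eE.
  by rewrite -ball_normE /= distrC normcE_cabs ltcR.
apply/nbhs_ballP; exists e%:C%C => /=; first by rewrite ltcR.
move=> y; rewrite -ball_normE /= distrC normcE_cabs ltcR; exact: eA.
Qed.

Lemma nbhs_rV_cabsP n (z : 'rV[R[i]]_n) (A : set 'rV[R[i]]_n) :
  nbhs z A <-> exists2 e, 0 < e &
    forall y : 'rV_n, (forall i, cabs (y ord0 i - z ord0 i) < e) -> A y.
Proof.
split=> [/nbhs_ballP[e /= e0 eA]|[e e0 eA]].
  move: e0; rewrite ltcE /= => /andP[/eqP Ie e0].
  have eE : e = (complex.Re e)%:C%C by case: e Ie {e0 eA} => a b /= ->.
  exists (complex.Re e) => // y yz; apply: eA.
  split; first by rewrite ltcE/= Ie eqxx.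
  move=> i j; rewrite ord1 eE.
  by rewrite -ball_normE /= distrC normcE_cabs ltcR.
apply/nbhs_ballP; exists e%:C%C => /=; first by rewrite ltcR.
move=> y [_ yz]; apply: eA => i; have := yz ord0 i.
by rewrite -ball_normE /= distrC normcE_cabs ltcR.
Qed.

Lemma lipschitz_cabs_continuous (f : R[i] -> R) :
  (forall y z, `|f y - f z| <= cabs (y - z)) -> continuous f.
Proof.
move=> fl z A /nbhs_ballP[e /= e0 eA]; apply/nbhs_cabsP; exists e => // y yz.
apply: eA; rewrite -ball_normE /= distrC; exact: le_lt_trans (fl _ _) yz.
Qed.

Lemma cabs_continuous : continuous (@cabs R).
Proof.
apply: lipschitz_cabs_continuous => y z; rewrite ler_norml.
have := ler_cabsB y z; have := ler_cabsB z y.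
rewrite cabs_distC; move: (cabs _) (cabs _) (cabs _) => a b c; lra.
Qed.

Lemma Re_continuous : continuous (@complex.Re R).
Proof.
apply: lipschitz_cabs_continuous => y z.
by have := ler_Re_cabs (y - z); case: y; case: z.
Qed.

Lemma Im_continuous : continuous (@complex.Im R).
Proof.
apply: lipschitz_cabs_continuous => y z.
by have := ler_Im_cabs (y - z); case: y; case: z.
Qed.

Lemma cvg_Complex (T : topologicalType) (F : set_system T) {FF : Filter F}
    (f g : T -> R) (a b : R) :
  f @ F --> a -> g @ F --> b -> (fun t => (f t +i* g t)%C) @ F --> (a +i* b)%C.
Proof.
move=> fa gb A /nbhs_cabsP[e e0 eA].
have e2 : 0 < e / 2 by rewrite divr_gt0.
move/cvgrPdist_lt/(_ _ e2) : fa => fa.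
move/cvgrPdist_lt/(_ _ e2) : gb => gb.
apply: (filterS2 _ _ fa gb) => t ft gt /=.
apply: eA; apply: le_lt_trans (ler_cabs_ReIm _) _.
by rewrite (splitr e) ltrD//= distrC.
Qed.

Lemma compact_cdisc (e : R) : compact [set z : R[i] | cabs z <= e].
Proof.
apply: (@subclosed_compact _ _
   ((fun p : R * R => (p.1 +i* p.2)%C) @` (`[-e, e] `*` `[-e, e]))).
- rewrite [X in closed X](_ : _ = @cabs R @^-1` [set x | x <= e])//.
  by apply: closed_comp; [move=> z _; exact: cabs_continuous|exact: closed_le].
- apply: continuous_compact; last by apply: compact_setX; exact: segment_compact.
  apply: continuous_subspaceT => -[a b].
  by apply: cvg_Complex; [exact: cvg_fst|exact: cvg_snd].
- move=> z /= ze; exists (complex.Re z, complex.Im z); last by case: (z).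
  by split; rewrite /= in_itv/= -ler_norml;
    [apply: le_trans (ler_Re_cabs _) ze|apply: le_trans (ler_Im_cabs _) ze].
Qed.

Lemma compact_cpolydisc n (r : R) :
  compact [set z : 'rV[R[i]]_n | forall i, cabs (z ord0 i) <= r].
Proof.
by apply: (@rV_compact R[i] n (fun=> [set x | cabs x <= r])) => _; exact: compact_cdisc.
Qed.

End ComplexModulus.

(** * The complex exponential *)

Section ComplexExponential.
Variable R : realType.
Implicit Types (z w : R[i]).

Lemma cexp0 : cexp (0 : R[i]) = 1.
Proof. by rewrite /cexp /= expR0 cos0 sin0 mulr1 mulr0. Qed.

Lemma cexpD z w : cexp (z + w) = cexp z * cexp w.
Proof.
case: z w => [a b] [c d]; rewrite /cexp /= expRD cosD sinD.
by apply/eqP; rewrite eq_complex /=; apply/andP; split; apply/eqP; ring.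
Qed.

Lemma cabs_cexp z : cabs (cexp z) = expR (complex.Re z).
Proof.
rewrite cabsE /= !exprMn -mulrDr cos2Dsin2 mulr1 sqrtr_sqr.
by rewrite ger0_norm ?expR_ge0.
Qed.

Lemma cexp_neq0 z : cexp z != 0.
Proof. by rewrite -cabs_gt0 cabs_cexp expR_gt0. Qed.

Lemma cexp_surj z : z != 0 -> exists w, cexp w = z.
Proof.
move=> z0; have c0 : 0 < cabs z by rewrite cabs_gt0.
case: z z0 c0 => a b z0 c0; set r := cabs _ in c0.
have rE : a ^+ 2 + b ^+ 2 = r ^+ 2.
  by rewrite /r cabsE /= sqr_sqrtr// addr_ge0 ?sqr_ge0.
have ar : -1 <= a / r <= 1.
  rewrite -ler_norml normrM normfV (gtr0_norm c0) ler_pdivrMr// mul1r.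
  exact: (ler_Re_cabs (a +i* b)%C).
have sr : sin (acos (a / r)) = `|b| / r.
  rewrite sin_acos// (_ : 1 - _ = (b / r) ^+ 2).
    by rewrite sqrtr_sqr normrM normfV (gtr0_norm c0).
  have r0 : r ^+ 2 != 0 by rewrite sqrf_eq0 gt_eqF.
  by rewrite !expr_div_n -(divff r0) -mulrBl -rE addrC addKr.
(* [acos] takes values in [0, pi]; the sign of [b] decides between this angle and its opposite. *)
exists (ln r +i* (if 0 <= b then acos (a / r) else - acos (a / r)))%C.
rewrite /cexp /= lnK ?posrE//; apply/eqP; rewrite eq_complex /=.
have rK x : r * (x / r) = x by rewrite mulrC divfK ?gt_eqF.
have [b0|b0] := lerP 0 b.
  by rewrite acosK// sr (ger0_norm b0) !rK !eqxx.
by rewrite cosN sinN acosK// sr (ltr0_norm b0) mulNr opprK !rK !eqxx.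
Qed.

Lemma cexp_continuous : continuous (@cexp R).
Proof.
move=> z; have cRe : @complex.Re R @ z --> complex.Re z := @Re_continuous R z.
have cIm : @complex.Im R @ z --> complex.Im z := @Im_continuous R z.
have eRe : (fun x : R[i] => expR (complex.Re x)) @ z --> expR (complex.Re z).
  by apply: (cvg_comp _ _ cRe); exact: continuous_expR.
have cosI : (fun x : R[i] => cos (complex.Im x)) @ z --> cos (complex.Im z).
  by apply: (cvg_comp _ _ cIm); exact: continuous_cos.
have sinI : (fun x : R[i] => sin (complex.Im x)) @ z --> sin (complex.Im z).
  by apply: (cvg_comp _ _ cIm); exact: continuous_sin.
exact: (@cvg_Complex R _ _ _ _ _ _ _ (cvgM eRe cosI) (cvgM eRe sinI)).
Qed.

End ComplexExponential.

(** * Goursat's theorem *)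

Section RealIntegral.
Variable R : realType.
Implicit Types (a b c e m : R) (u v : R -> R).

Local Notation RI a b u := (\int[@lebesgue_measure R]_(x in `[a, b]) u x)%R.

Definition continuous_on a b u := forall x, a <= x <= b -> {for x, continuous u}.

Lemma continuous_on_integrable a b u : continuous_on a b u ->
  (@lebesgue_measure R).-integrable `[a, b] (EFin \o u).
Proof.
move=> cu; apply: continuous_compact_integrable; first exact: segment_compact.
apply: continuous_in_subspaceT => x; rewrite inE /= in_itv /= => xab.
exact: cu.
Qed.

Lemma Rintegral_chasles a m b u : a <= m <= b -> continuous_on a b u ->
  RI a b u = RI a m u + RI m b u.
Proof.
move=> /andP[am mb] cu; have iu := continuous_on_integrable cu.
have := @Rintegral_itvB R u (BLeft a) (BRight b) m iu.
rewrite !bnd_simp => /(_ am mb) H; rewrite -[LHS](subrK (RI a m u)) addrC.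
congr (_ + _); rewrite H; apply: Rintegral_itv_obnd_cbnd.
apply: integrableS iu => //; apply: subset_itvr; rewrite bnd_simp.
exact: am.
Qed.

Lemma Rintegral_segment_cst a b c : a <= b -> RI a b (fun=> c) = c * (b - a).
Proof.
move=> ab; rewrite Rintegral_cst//= lebesgue_measure_itv/= lte_fin.
by case: ltgtP ab => // -> _; rewrite subrr.
Qed.

Lemma Rintegral_approx a b c e u : a <= b -> continuous_on a b u ->
  (forall x, a <= x <= b -> `|u x - c| <= e) ->
  `|RI a b u - c * (b - a)| <= e * (b - a).
Proof.
move=> ab cu ue; have iu := continuous_on_integrable cu.
have ic k : (@lebesgue_measure R).-integrable `[a, b] (EFin \o cst k).
  by apply: continuous_on_integrable => x _; exact: cvg_cst.
have up : RI a b u <= RI a b (fun=> c + e).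
  apply: le_Rintegral => [//|||x]; [exact: iu|exact: ic|].
  rewrite /= in_itv /= => /ue.
  by rewrite ler_norml; move: (u x) => y; lra.
have lo : RI a b (fun=> c - e) <= RI a b u.
  apply: le_Rintegral => [//|||x]; [exact: ic|exact: iu|].
  rewrite /= in_itv /= => /ue.
  by rewrite ler_norml; move: (u x) => y; lra.
move: up lo; rewrite !Rintegral_segment_cst// ler_norml.
by move: (RI a b u) => I; nra.
Qed.

End RealIntegral.

Section Goursat.
Variable R : realType.
Implicit Types (P Q : R -> R -> R) (s t e d : R).

Local Notation RI a b u := (\int[@lebesgue_measure R]_(x in `[a, b]) u x)%R.

(* Complex differentiability of P + i Q at s + i t, in real terms. *)
Definition cauchy_riemann P Q s t := exists al be : R, forall e, 0 < e ->
  exists2 d, 0 < d & forall s' t', `|s' - s| < d -> `|t' - t| < d ->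
    `|P s' t' - P s t - (al * (s' - s) - be * (t' - t))|
       <= e * (`|s' - s| + `|t' - t|) /\
    `|Q s' t' - Q s t - (be * (s' - s) + al * (t' - t))|
       <= e * (`|s' - s| + `|t' - t|).

Let lipschitz_at_continuous (u : R -> R) (x k d : R) : 0 < d -> 0 <= k ->
  (forall y, `|y - x| < d -> `|u y - u x| <= k * `|y - x|) ->
  {for x, continuous u}.
Proof.
move=> d0 k0 uk A /nbhs_ballP[e /= e0 eA].
have k1 : 0 < k + 1 by lra.
apply/nbhs_ballP; exists (Num.min d (e / (k + 1))) => /=.
  by rewrite lt_min d0 divr_gt0.
move=> y; rewrite -ball_normE /= distrC lt_min => /andP[yd].
rewrite ltr_pdivlMr// => ye; apply: eA; rewrite -ball_normE /= distrC.
apply: le_lt_trans (uk _ yd) _.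
by move: (`|y - x|) (normr_ge0 (y - x)) ye => w; nra.
Qed.

(** [P] will be integrated along vertical sides of rectangles and [Q] along horizontal ones, hence
    continuity of [P] in the second variable here and of [Q] in the first one below. *)
Lemma cauchy_riemann_continuous_l P Q s t : cauchy_riemann P Q s t ->
  {for t, continuous (P s)}.
Proof.
move=> [al [be]] /(_ 1 ltr01)[d d0 H].
apply: (lipschitz_at_continuous d0 (k := 1 + `|be|)) => [|y yd].
  by rewrite addr_ge0.
have [] := H s y; rewrite ?subrr ?normr0// mulr0 !add0r mul1r => + _.
move=> h; rewrite mulrDl mul1r -normrM.
have := ler_normD (P s y - P s t - - (be * (y - t))) (- (be * (y - t))).
by rewrite subrK normrN => /le_trans; apply; rewrite lerD2r.
Qed.

Lemma cauchy_riemann_continuous_r P Q s t : cauchy_riemann P Q s t ->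
  {for s, continuous (Q ^~ t)}.
Proof.
move=> [al [be]] /(_ 1 ltr01)[d d0 H].
apply: (lipschitz_at_continuous d0 (k := 1 + `|be|)) => [|y yd].
  by rewrite addr_ge0.
have [] := H y t; rewrite ?subrr ?normr0// !mulr0 !addr0 mul1r => _.
move=> h; rewrite mulrDl mul1r -normrM.
have := ler_normD (Q y t - Q s t - (be * (y - s))) (be * (y - s)).
by rewrite subrK => /le_trans; apply; rewrite lerD2r.
Qed.

(** The imaginary part of the integral of (P + iQ)(ds + i dt) counterclockwise around the rectangle;
    it is the part in which [P] occurs on the vertical sides. *)
Definition rect_form P Q (s1 s2 t1 t2 : R) : R :=
  RI t1 t2 (fun t => P s2 t - P s1 t) - RI s1 s2 (fun s => Q s t2 - Q s t1).

Section Fixed.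
Variables (P Q : R -> R -> R) (S : R).
Hypothesis PQ : forall s t, s < S -> cauchy_riemann P Q s t.

Local Notation mu := (rect_form P Q).

Let cP s s' t : s < S -> s' < S -> {for t, continuous (fun t => P s t - P s' t)}.
Proof.
by move=> sS s'S; apply: continuousB; apply: cauchy_riemann_continuous_l (PQ _ _).
Qed.

Let cQ s t t' : s < S -> {for s, continuous (fun s => Q s t - Q s t')}.
Proof.
by move=> sS; apply: continuousB;
  [apply: cauchy_riemann_continuous_r (PQ t _)
  |apply: cauchy_riemann_continuous_r (PQ t' _)].
Qed.

Let mu_s s1 s s2 t1 t2 : s1 <= s <= s2 -> s2 < S ->
  mu s1 s2 t1 t2 = mu s1 s t1 t2 + mu s s2 t1 t2.
Proof.
move=> /andP[s1s ss2] s2S; rewrite /rect_form.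
have sS : s < S by exact: le_lt_trans s2S.
have s1S : s1 < S by exact: le_lt_trans sS.
rewrite [X in _ - X](@Rintegral_chasles _ _ s) ?s1s//; last first.
  by move=> x /andP[_ xs]; apply: cQ; exact: le_lt_trans s2S.
suff -> : RI t1 t2 (fun t => P s2 t - P s1 t) = RI t1 t2 (fun t => P s t - P s1 t) +
  RI t1 t2 (fun t => P s2 t - P s t) by ring.
rewrite -RintegralD//.
- by apply: eq_Rintegral => x _; ring.
- by apply: continuous_on_integrable => x _; exact: cP.
- by apply: continuous_on_integrable => x _; exact: cP.
Qed.

Let mu_t s1 s2 t1 t t2 : s1 <= s2 -> t1 <= t <= t2 -> s2 < S ->
  mu s1 s2 t1 t2 = mu s1 s2 t1 t + mu s1 s2 t t2.
Proof.
move=> s12 t12 s2S; rewrite /rect_form.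
have s1S : s1 < S by exact: le_lt_trans s2S.
rewrite [X in X - _](@Rintegral_chasles _ _ t)//; last by move=> x _; exact: cP.
suff -> : RI s1 s2 (fun s => Q s t2 - Q s t1) = RI s1 s2 (fun s => Q s t - Q s t1) +
  RI s1 s2 (fun s => Q s t2 - Q s t) by ring.
have i t' t'' : (@lebesgue_measure R).-integrable `[s1, s2]
    (EFin \o (fun s => Q s t' - Q s t'')).
  apply: continuous_on_integrable => x /andP[_ xs]; apply: cQ.
  exact: le_lt_trans s2S.
by rewrite -RintegralD//; apply: eq_Rintegral => x _; ring.
Qed.

(** The affine approximation at (s0, t0) contributes [(al * a) * b] through the vertical sides and
    [(al * b) * a] through the horizontal ones, which cancel. What remains is the approximation
    error, of order e times side length, integrated over the sides. *)
Let mu_small s0 t0 : s0 < S -> forall e, 0 < e -> exists2 d, 0 < d &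
  forall s1 t1 a b, 0 <= a < d -> 0 <= b < d -> s1 <= s0 <= s1 + a ->
    t1 <= t0 <= t1 + b -> s1 + a < S ->
    `|mu s1 (s1 + a) t1 (t1 + b)| <= e * (a + b) ^+ 2.
Proof.
move=> s0S e e0; have [al [be H]] := PQ t0 s0S.
have e2 : 0 < e / 2 by rewrite divr_gt0.
have [d d0 {}H] := H _ e2; exists d => // s1 t1 a b.
move=> /andP[a0 ad] /andP[b0 bd] /andP[sa sb] /andP[ta tb] sS.
have s1S : s1 < S by lra.
have near0 s' t' : s1 <= s' <= s1 + a -> t1 <= t' <= t1 + b ->
  [/\ `|s' - s0| <= a, `|t' - t0| <= b,
    `|P s' t' - P s0 t0 - (al * (s' - s0) - be * (t' - t0))| <= e / 2 * (a + b) &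
    `|Q s' t' - Q s0 t0 - (be * (s' - s0) + al * (t' - t0))| <= e / 2 * (a + b)].
  move=> s's t't.
  have sd : `|s' - s0| <= a by rewrite ler_norml; lra.
  have td : `|t' - t0| <= b by rewrite ler_norml; lra.
  have [hP hQ] := H s' t' (le_lt_trans sd ad) (le_lt_trans td bd).
  have k : e / 2 * (`|s' - s0| + `|t' - t0|) <= e / 2 * (a + b).
    by rewrite ler_wpM2l ?lerD// ltW.
  by split=> //; [exact: le_trans hP k|exact: le_trans hQ k].
have ba : s1 <= s1 + a by lra.
have bb : t1 <= t1 + b by lra.
have sr : s1 <= s1 + a <= s1 + a by rewrite ba lexx.
have sl : s1 <= s1 <= s1 + a by rewrite ba lexx.
have tr : t1 <= t1 + b <= t1 + b by rewrite bb lexx.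
have tl : t1 <= t1 <= t1 + b by rewrite bb lexx.
have HP : `|RI t1 (t1 + b) (fun t => P (s1 + a) t - P s1 t) - (al * a) * b|
    <= e * (a + b) * b.
  have /= := @Rintegral_approx R t1 (t1 + b) (al * a) (e * (a + b))
     (fun t => P (s1 + a) t - P s1 t) bb.
  rewrite (addrC t1) addrK; apply => [x _|x xt]; first exact: cP.
  have xt' : t1 <= x <= t1 + b by rewrite (addrC t1).
  have [_ _ + _] := near0 (s1 + a) x sr xt'; have [_ _ + _] := near0 s1 x sl xt'.
  rewrite !ler_norml; move: (P _ _) (P _ _) (P _ _) => p1 p2 p3; lra.
have HQ : `|RI s1 (s1 + a) (fun s => Q s (t1 + b) - Q s t1) - (al * b) * a|
    <= e * (a + b) * a.
  have /= := @Rintegral_approx R s1 (s1 + a) (al * b) (e * (a + b))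
     (fun s => Q s (t1 + b) - Q s t1) ba.
  rewrite (addrC s1) addrK; apply => [x xs|x xs].
    by apply: cQ; lra.
  have xs' : s1 <= x <= s1 + a by rewrite (addrC s1).
  have [_ _ _] := near0 x (t1 + b) xs' tr; have [_ _ _] := near0 x t1 xs' tl.
  rewrite !ler_norml; move: (Q _ _) (Q _ _) (Q _ _) => p1 p2 p3; lra.
move: HP HQ; rewrite /rect_form.
set I1 := Rintegral _ _ _; set I2 := Rintegral _ _ _; rewrite !ler_norml.
have -> : e * (a + b) ^+ 2 = e * (a + b) * b + e * (a + b) * a by ring.
by move: I1 I2 (e * (a + b) * b) (e * (a + b) * a) => I1 I2 u v; lra.
Qed.

(** Repeated bisection: one quarter always carries at least a quarter of the absolute value, so the
    k-th rectangle carries at least m / 4^k. At the common point [mu_small] bounds it by e (A + B)^2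
    / 4^k, and the powers of 4 cancel. *)
Lemma goursat s1 s2 t1 t2 : s1 <= s2 -> t1 <= t2 -> s2 < S ->
  mu s1 s2 t1 t2 = 0.
Proof.
move=> s12 t12 s2S; pose A := s2 - s1; pose B := t2 - t1.
pose m := `|mu s1 s2 t1 t2|.
have A0 : 0 <= A by rewrite subr_ge0.
have B0 : 0 <= B by rewrite subr_ge0.
pose good k (p : R * R) := [/\ s1 <= p.1, p.1 + A / 2 ^+ k <= s2 &
  m / 4 ^+ k <= `|mu p.1 (p.1 + A / 2 ^+ k) p.2 (p.2 + B / 2 ^+ k)|].
pose sub k (p p' : R * R) := [/\ p.1 <= p'.1, p.2 <= p'.2,
  p'.1 + A / 2 ^+ k.+1 <= p.1 + A / 2 ^+ k &
  p'.2 + B / 2 ^+ k.+1 <= p.2 + B / 2 ^+ k].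
have half (x : R) k : x / 2 ^+ k = x / 2 ^+ k.+1 + x / 2 ^+ k.+1.
  have k2 : 2 ^+ k != 0 :> R by rewrite expf_neq0.
  by rewrite exprS; field.
have quarter k : m / 4 ^+ k = 4 * (m / 4 ^+ k.+1).
  have k2 : 4 ^+ k != 0 :> R by rewrite expf_neq0.
  by rewrite exprS; field.
(* Stated as an implication so that the choice function is total; for a pair that is not good any
   value will do. *)
have step k p : exists p', good k p -> good k.+1 p' /\ sub k p p'.
  have [gp|ngp] := pselect (good k p); last by exists p.
  case: p gp => x y [/= sx xs mp].
  set a := A / 2 ^+ k.+1; set b := B / 2 ^+ k.+1.
  have a0 : 0 <= a by rewrite divr_ge0// exprn_ge0.
  have b0 : 0 <= b by rewrite divr_ge0// exprn_ge0.
  move: mp xs; rewrite (half A) (half B) -/a -/b quarter => mp xs.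
  rewrite (addrA x) (addrA y) in mp; rewrite (addrA x) in xs.
  have split4 : mu x (x + a + a) y (y + b + b) =
      mu x (x + a) y (y + b) + mu x (x + a) (y + b) (y + b + b) +
      (mu (x + a) (x + a + a) y (y + b) +
       mu (x + a) (x + a + a) (y + b) (y + b + b)).
    clear mp; rewrite (@mu_s _ (x + a)); [|lra|lra].
    by congr (_ + _); apply: mu_t; lra.
  have [x' [y' [xx' yy' h]]] : exists x' y', [/\ x' = x \/ x' = x + a,
      y' = y \/ y' = y + b & m / 4 ^+ k.+1 <= `|mu x' (x' + a) y' (y' + b)|].
    apply/not_existsP => /= H.
    have H' x' y' : x' = x \/ x' = x + a -> y' = y \/ y' = y + b ->
        `|mu x' (x' + a) y' (y' + b)| < m / 4 ^+ k.+1.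
      move=> hx hy; rewrite ltNge; apply/negP => hm.
      by apply: (H x'); exists y'.
    move: mp; rewrite split4 leNgt => /negP; apply.
    have h1 := H' x y (or_introl erefl) (or_introl erefl).
    have h2 := H' x (y + b) (or_introl erefl) (or_intror erefl).
    have h3 := H' (x + a) y (or_intror erefl) (or_introl erefl).
    have h4 := H' (x + a) (y + b) (or_intror erefl) (or_intror erefl).
    apply: le_lt_trans (ler_normD _ _) _.
    have := ler_normD (mu x (x + a) y (y + b)) (mu x (x + a) (y + b) (y + b + b)).
    have := ler_normD (mu (x + a) (x + a + a) y (y + b))
       (mu (x + a) (x + a + a) (y + b) (y + b + b)).
    lra.
  exists (x', y') => _; rewrite /good /sub /= -/a -/b (half A) (half B) -/a -/b.
  have hx : x <= x' <= x + a by case: xx' => ->; lra.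
  have hy : y <= y' <= y + b by case: yy' => ->; lra.
  clear mp split4 xx' yy'; split; split=> //; clear h; lra.
have step' (kp : nat * (R * R)) : exists p',
  good kp.1 kp.2 -> good kp.1.+1 p' /\ sub kp.1 kp.2 p' := step kp.1 kp.2.
have [nxt nxtP] := choice step'.
pose sq := fix sq k := if k is k'.+1 then nxt (k', sq k') else (s1, t1).
have sqG k : good k (sq k).
  elim: k => [|k IH]; last by have [] := nxtP (k, sq k) IH.
  by split=> /=; rewrite ?expr0 ?divr1 /A /B ?(addrC s1) ?(addrC t1) ?subrK.
have sqS k : sub k (sq k) (sq k.+1) by have [] := nxtP (k, sq k) (sqG k).
have nested (f w : nat -> R) : (forall k, f k <= f k.+1) ->
    (forall k, f k.+1 + w k.+1 <= f k + w k) -> (forall k, 0 <= w k) ->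
    exists x, forall k, f k <= x <= f k + w k.
  move=> fi fd w0.
  have fh : {homo f : i j / (i <= j)%N >-> i <= j}.
    by apply: homo_leq => // x y z; exact: le_trans.
  have gh : {homo (fun k => f k + w k) : i j / (i <= j)%N >-> j <= i}.
    apply: (@homo_leq _ _ (fun x y => y <= x)) => //.
    by move=> y x z xy yz; exact: le_trans yz xy.
  have ub i j : f i <= f j + w j.
    have h1 := fh _ _ (leq_maxl i j); have h2 := gh _ _ (leq_maxr i j).
    by have := w0 (maxn i j); move: h1 h2 => /=; lra.
  exists (sup (range f)) => k; apply/andP; split.
    apply: ub_le_sup; last by exists k.
    by exists (f k + w k) => _ [i _ <-].
  by apply: ge_sup; [exists (f 0), 0|move=> _ [i _ <-]].
have wge0 (x : R) k : 0 <= x -> 0 <= x / 2 ^+ k.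
  by move=> x0; rewrite divr_ge0// exprn_ge0.
have [s0 s0P] := nested (fun k => (sq k).1) (fun k => A / 2 ^+ k)
  (fun k => let: And4 h _ _ _ := sqS k in h)
  (fun k => let: And4 _ _ h _ := sqS k in h) (fun k => wge0 _ k A0).
have [t0 t0P] := nested (fun k => (sq k).2) (fun k => B / 2 ^+ k)
  (fun k => let: And4 _ h _ _ := sqS k in h)
  (fun k => let: And4 _ _ _ h := sqS k in h) (fun k => wge0 _ k B0).
have s0S : s0 < S.
  apply: le_lt_trans s2S; have /andP[_ /le_trans] := s0P 0; apply.
  by have [] := sqG 0.
have small x d : 0 <= x -> 0 < d -> \forall k \near \oo, 0 <= x / 2 ^+ k < d.
  move=> x0 d0; have : (fun k => x * (2^-1) ^+ k) @ \oo --> (x * 0 : R).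
    by apply: cvgMr; apply: cvg_expr; rewrite gtr0_norm ?invr_gt0// invf_lt1// ltr1n.
  rewrite mulr0 => /cvgrPdist_lt /(_ _ d0) H.
  near=> k; rewrite wge0//=.
  have : `|0 - x * 2^-1 ^+ k| < d by near: k.
  rewrite sub0r normrN exprVn ger0_norm// wge0//.
apply/eqP; rewrite -normr_eq0 -/m eq_le normr_ge0 andbT.
apply/ler_addgt0Pl => e e0; rewrite addr0.
(* The added 1 keeps the divisor positive when the rectangle is a point. *)
have AB1 : 0 < (A + B) ^+ 2 + 1 by rewrite ltr_wpDl// sqr_ge0.
have [d d0 H] := mu_small t0 s0S (divr_gt0 e0 AB1).
have [k [ha hb]] : exists k, 0 <= A / 2 ^+ k < d /\ 0 <= B / 2 ^+ k < d.
  near \oo => k; exists k; split; near: k; exact: small.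
have [g1 g2 g3] := sqG k.
have := H (sq k).1 (sq k).2 _ _ ha hb (s0P k) (t0P k) (le_lt_trans g2 s2S).
move=> /(le_trans g3); rewrite -mulrDl expr_div_n -exprM mulnC exprM.
have -> : (2 : R) ^+ 2 = 4 by ring.
rewrite mulrA ler_pM2r ?invr_gt0 ?exprn_gt0//.
move/le_trans; apply; rewrite mulrAC ler_pdivrMr//.
by rewrite ler_wpM2l ?ltW// ltrDl.
Unshelve. all: by end_near. Qed.

End Fixed.
End Goursat.

(** * The maximum principle *)

Section MaximumPrinciple.
Variable R : realType.
Implicit Types (G : R[i] -> R[i]) (z w D : R[i]).

(** A form without division that allows [h = 0]: in the chain rule the increment of the inner
    function may vanish. *)
Definition cderiv G z D := forall e : R, 0 < e -> exists2 d : R, 0 < d &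
  forall h, cabs h < d -> cabs (G (z + h) - G z - D * h) <= e * cabs h.

Lemma differentiable_cderiv G z : differentiable G z -> exists D, cderiv G z D.
Proof.
move=> /derivable1_diffP dG; exists ('D_1 G z) => e e0.
have cG : (fun h => h^-1 *: ((G \o shift z) (h *: (1 : R[i])) - G z)) @ 0^' -->
  'D_1 G z by exact: dG.
have := cG [set y | cabs (y - 'D_1 G z) < e].
have nb : nbhs ('D_1 G z) [set y | cabs (y - 'D_1 G z) < e].
  by apply/nbhs_cabsP; exists e.
move=> /(_ nb) /nbhs_cabsP[d d0 Hd]; exists d => // h hd.
have [->|h0] := eqVneq h 0; first by rewrite addr0 subrr mulr0 subr0 cabs0 mulr0.
have := Hd h; rewrite subr0 => /(_ hd h0) /=.
rewrite [_ *: 1]mulr1 => /ltW; rewrite -(ler_pM2r (_ : 0 < cabs h)) ?cabs_gt0//.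
apply: le_trans; rewrite -cabsM mulrBl.
by rewrite [h^-1 *: _ * h]mulrC -[h^-1 *: _]/(h^-1 * _) mulrA divff// mul1r (addrC z).
Qed.

Lemma cderiv_comp (F G : R[i] -> R[i]) z D E :
  cderiv F z E -> cderiv G (F z) D -> cderiv (G \o F) z (D * E).
Proof.
move=> dF dG e e0.
have k0 : 0 < cabs E + 1 by rewrite ltr_wpDl ?cabs_ge0.
have l0 : 0 < cabs D + 1 by rewrite ltr_wpDl ?cabs_ge0.
have [d1 d10 H1] := dG _ (divr_gt0 (divr_gt0 e0 (ltr0n _ 2)) k0).
have [d2 d20 H2] := dF _ (divr_gt0 (divr_gt0 e0 (ltr0n _ 2)) l0).
have [d3 d30 H3] := dF _ ltr01.
exists (Num.min (Num.min d2 d3) (d1 / (cabs E + 1))).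
  by rewrite !lt_min d20 d30 divr_gt0.
move=> h; rewrite !lt_min => /andP[/andP[hd2 hd3]]; rewrite ltr_pdivlMr// => hd1.
pose k := F (z + h) - F z.
have kh : cabs k <= (cabs E + 1) * cabs h.
  have -> : k = (k - E * h) + E * h by rewrite subrK.
  apply: le_trans (ler_cabsD _ _) _; rewrite cabsM.
  by have := H3 h hd3; rewrite -/k; lra.
have kd : cabs k < d1 by apply: le_lt_trans kh _; rewrite mulrC.
have := H1 k kd; rewrite {1}/k (addrC (F z)) subrK => H1k.
have H2h := H2 h hd2; rewrite -/k in H2h.
have -> : (G \o F) (z + h) - (G \o F) z - D * E * h =
    (G (F (z + h)) - G (F z) - D * k) + D * (k - E * h) by rewrite /=; ring.
apply: le_trans (ler_cabsD _ _) _; rewrite cabsM [e]splitr mulrDl.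
apply: lerD.
  apply: le_trans H1k _; rewrite mulrAC ler_pdivrMr// -[leRHS]mulrA.
  by rewrite ler_wpM2l ?divr_ge0 ?(ltW e0)// mulrC.
apply: le_trans (_ : (cabs D + 1) * cabs (k - E * h) <= _).
  by rewrite ler_wpM2r ?cabs_ge0// lerDl.
apply: le_trans (_ : (cabs D + 1) * (e / 2 / (cabs D + 1) * cabs h) <= _).
  by rewrite ler_wpM2l// ltW.
by rewrite mulrA (mulrC (cabs D + 1)) divfK// gt_eqF.
Qed.

Lemma real_deriv_approx (u : R -> R) (x d : R) : is_derive x (1 : R) u d ->
  forall e : R, 0 < e -> exists2 r : R, 0 < r &
    forall h : R, `|h| < r -> `|u (x + h) - u x - d * h| <= e * `|h|.
Proof.
move=> [du <-] e e0.
have cu : (fun h => h^-1 *: ((u \o shift x) (h *: (1 : R)) - u x)) @ 0^' --> 'D_1 u x by exact: du.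
move/cvgrPdist_lt: cu => /(_ e e0) /nbhs_ballP[r /= r0 Hr]; exists r => // h hr.
have [->|h0] := eqVneq h 0; first by rewrite addr0 subrr mulr0 subr0 normr0 mulr0.
have := Hr h; rewrite -ball_normE /= sub0r normrN => /(_ hr h0).
rewrite [_ *: 1]mulr1 => /ltW; rewrite -(ler_pM2r (_ : 0 < `|h|)) ?normr_gt0//.
apply: le_trans; rewrite -normrM mulrBl distrC.
by rewrite [_ *: _]mulrC divfK// (addrC x).
Qed.

Lemma cderiv_cexp w : cderiv (@cexp R) w (cexp w).
Proof.
move=> e e0; have c0 : 0 < cabs (cexp w) by rewrite cabs_gt0 cexp_neq0.
(* The 8 is 1 + 2 + 4 + 1, from the bounds [b1], [b2], [b3] and the error of [sin]. Increments
   smaller than [e1] turn the quadratic term [V * V] into a multiple of [e1]. *)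
pose e1 := Num.min 1 (e / cabs (cexp w) / 8).
have e10 : 0 < e1 by rewrite lt_min ltr01 !divr_gt0.
have e11 : e1 <= 1 by rewrite ge_min lexx.
have [d1 d10 H1] := real_deriv_approx (is_derive_expR 0) e10.
have [d2 d20 H2] := real_deriv_approx (is_derive_cos 0) e10.
have [d3 d30 H3] := real_deriv_approx (is_derive_sin 0) e10.
exists (Num.min (Num.min d1 d2) (Num.min d3 e1)).
  by rewrite !lt_min d10 d20 d30 ltr01/= !divr_gt0.
move=> v; rewrite lt_min => /andP[]; rewrite !(lt_min _ d1) (lt_min _ d3).
move=> /andP[vd1 vd2] /andP[vd3 ve1].
have -> : cexp (w + v) - cexp w - cexp w * v = cexp w * (cexp v - 1 - v).
  by rewrite cexpD; ring.
suff : cabs (cexp v - 1 - v) <= 8 * e1 * cabs v.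
  rewrite cabsM -(ler_pM2l c0) => /le_trans; apply.
  rewrite mulrA ler_wpM2r ?cabs_ge0// mulrC -ler_pdivlMr// mulrC -ler_pdivlMr//.
  by rewrite ge_min lexx orbT.
case: v vd1 vd2 vd3 ve1 => a b vd1 vd2 vd3 ve1.
have la : `|a| <= cabs (a +i* b)%C by exact: (ler_Re_cabs (a +i* b)%C).
have lb : `|b| <= cabs (a +i* b)%C by exact: (ler_Im_cabs (a +i* b)%C).
apply: le_trans (ler_cabs_ReIm _) _; rewrite /cexp /= subr0.
move: (cabs _) vd1 vd2 vd3 ve1 la lb (cabs_ge0 (a +i* b)%C) => V vd1 vd2 vd3 ve1 la lb V0.
have := H1 a (le_lt_trans la vd1); rewrite add0r expR0 mul1r => h1.
have := H2 b (le_lt_trans lb vd2); rewrite add0r sin0 cos0 oppr0 mul0r subr0 => h2.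
have := H3 b (le_lt_trans lb vd3); rewrite add0r sin0 cos0 mul1r subr0 => h3.
have c1 : `|cos b| <= 1 by rewrite ler_norml cos_geN1 cos_le1.
have E1 : e1 * `|a| <= e1 * V by rewrite ler_wpM2l// ltW.
have E2 : e1 * `|b| <= e1 * V by rewrite ler_wpM2l// ltW.
have E3 : V * V <= e1 * V by rewrite ler_wpM2r// ltW.
have E4 : e1 * V <= V by rewrite -[leRHS]mul1r ler_wpM2r.
have V1 : V <= 1 by exact: le_trans (ltW ve1) e11.
have -> : expR a * cos b - 1 - a =
  (expR a - 1 - a) * cos b + (1 + a) * (cos b - 1) by ring.
have -> : expR a * sin b - b =
  ((expR a - 1 - a) + a) * ((sin b - b) + b) + (sin b - b) by ring.
move: (expR a - 1 - a) (cos b - 1) (sin b - b) h1 h2 h3 => p c s h1 h2 h3.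
have b1 : `|p * cos b| <= e1 * V.
  rewrite normrM -[leRHS]mulr1 ler_pM//; exact: le_trans h1 E1.
have b2 : `|(1 + a) * c| <= 2 * (e1 * V).
  rewrite normrM ler_pM//; last exact: le_trans h2 E2.
  by apply: le_trans (ler_normD _ _) _; rewrite normr1; lra.
have b3 : `|(p + a) * (s + b)| <= (2 * V) * (2 * V).
  by rewrite normrM ler_pM//; apply: le_trans (ler_normD _ _) _; lra.
have := ler_normD (p * cos b) ((1 + a) * c).
have := ler_normD ((p + a) * (s + b)) s.
have -> : 8 * e1 * V = 8 * (e1 * V) by ring.
have : (2 * V) * (2 * V) <= 4 * (e1 * V).
  have -> : 2 * V * (2 * V) = 4 * (V * V) by ring.
  lra.
lra.
Qed.

Lemma cderiv_affine z (l : R[i]) w : cderiv (fun v => z + l * v) w l.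
Proof.
move=> e e0; exists 1 => // h _.
rewrite (_ : _ - _ = 0) ?cabs0 ?mulr_ge0 ?cabs_ge0 ?(ltW e0)//.
by ring.
Qed.

Lemma cderiv_scale (l : R[i]) w : cderiv (fun v => l * v) w l.
Proof.
move=> e e0; exists 1 => // h _.
rewrite (_ : _ - _ = 0) ?cabs0 ?mulr_ge0 ?cabs_ge0 ?(ltW e0)//.
by ring.
Qed.

Lemma cderiv_cauchy_riemann (H : R[i] -> R[i]) (s t : R) D :
  cderiv H (s +i* t)%C D ->
  cauchy_riemann (fun s t => complex.Re (H (s +i* t)%C))
    (fun s t => complex.Im (H (s +i* t)%C)) s t.
Proof.
move=> dH; exists (complex.Re D), (complex.Im D) => e e0.
have [d d0 Hd] := dH e e0; exists (d / 2) => [|s' t' sd td]; first by rewrite divr_gt0.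
have hE : ((s +i* t) + ((s' - s) +i* (t' - t)) = s' +i* t')%C.
  by apply/eqP; rewrite eq_complex /= !subrKC !eqxx.
have hb := ler_cabs_ReIm ((s' - s) +i* (t' - t))%C; rewrite /= in hb.
have hd : cabs ((s' - s) +i* (t' - t))%C < d.
  by apply: le_lt_trans hb _; rewrite [d]splitr ltrD.
have := Hd _ hd; rewrite hE => Hh.
have {Hh} : cabs (H (s' +i* t')%C - H (s +i* t)%C - D * ((s' - s) +i* (t' - t))%C)
   <= e * (`|s' - s| + `|t' - t|).
  by apply: le_trans Hh _; rewrite ler_wpM2l// ltW.
move: (H _) (H _) => [a b] [c d']; case: D {dH Hd} => al be Hh.
split.
  apply: le_trans Hh; apply: le_trans (ler_Re_cabs _); rewrite le_eqVlt.
  by apply/orP; left; apply/eqP; congr `|_| => /=; ring.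
apply: le_trans Hh; apply: le_trans (ler_Im_cabs _); rewrite le_eqVlt.
by apply/orP; left; apply/eqP; congr `|_| => /=; ring.
Qed.

Lemma cexp_periodic (s t : R) : cexp (s +i* (t + 2 * pi))%C = cexp (s +i* t)%C.
Proof.
by rewrite /cexp /= mulr_natl cosD2pi sinD2pi.
Qed.

(* The mean of Re G over circles of radius exp s is independent of s by Goursat's
   theorem for G (z + exp (s + i t)) on rectangles, and tends to Re (G z) as s
   tends to -oo. *)
Lemma mean_value_le G z (r B : R) : 0 < r ->
  (exists2 r', r < r' & forall h, cabs h < r' -> exists D, cderiv G (z + h) D) ->
  (forall h, cabs h = r -> complex.Re (G (z + h)) <= B) ->
  complex.Re (G z) <= B.
Proof.
move=> r0 [r' rr' dG] GB.
have r'0 : 0 < r' by exact: lt_trans rr'.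
pose H v := G (z + 1 * cexp v).
pose P s t := complex.Re (H (s +i* t)%C).
pose Q s t := complex.Im (H (s +i* t)%C).
have CR s t : s < ln r' -> cauchy_riemann P Q s t.
  move=> sr; have [|D dD] := dG (cexp (s +i* t)%C).
    by rewrite cabs_cexp /= -[ltRHS]lnK ?posrE// ltr_expR.
  apply: (@cderiv_cauchy_riemann H s t (D * (1 * cexp (s +i* t)%C))).
  apply: (@cderiv_comp (fun v => z + 1 * cexp v) G); last by rewrite mul1r.
  apply: (@cderiv_comp (@cexp R) (fun v => z + 1 * v)); first exact: cderiv_cexp.
  exact: cderiv_affine.
have pi20 : 0 < 2 * pi :> R by rewrite mulr_gt0// pi_gt0.
apply/ler_addgt0Pl => e e0.
have [D dD] : exists D, cderiv G z D.
  by have := dG 0; rewrite addr0; apply; rewrite cabs0.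
have [d d0 Hd] := dD 1 ltr01.
pose k := cabs D + 1.
have k0 : 0 < k by rewrite ltr_wpDl ?cabs_ge0.
(* The small circle lies where the derivative at z controls [G], it is not larger than the given
   one, and [rho * k <= e] makes [G] vary by at most [e] on it. *)
pose rho := Num.min (Num.min (d / 2) r) (e / k).
have rho0 : 0 < rho by rewrite !lt_min !divr_gt0// r0.
have rhod : rho < d.
  apply: (@le_lt_trans _ _ (d / 2)); first by rewrite /rho !ge_min lexx.
  by rewrite ltr_pdivrMr// ltr_pMr// ltr1n.
have rhor : rho <= r by rewrite /rho !ge_min lexx orbT.
have rhok : rho * k <= e by rewrite -ler_pdivlMr// /rho !ge_min lexx !orbT.
have s12 : ln rho <= ln r by rewrite ler_ln ?posrE.
have s2S : ln r < ln r' by rewrite ltr_ln ?posrE.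
have := @goursat R P Q (ln r') CR (ln rho) (ln r) 0 (2 * pi) s12 (ltW pi20) s2S.
(* By periodicity the two horizontal sides cancel, so the vertical sides have equal integrals. *)
have Qper s : Q s (2 * pi) = Q s 0 by rewrite /Q /H -[2 * pi]add0r cexp_periodic.
have Q0 : Rintegral (@lebesgue_measure R) `[ln rho, ln r]
    (fun s => Q s (2 * pi) - Q s 0) = 0.
  under eq_Rintegral do rewrite Qper subrr.
  by rewrite Rintegral_segment_cst// mul0r.
rewrite /rect_form Q0 subr0; set I := Rintegral _ _ _ => I0.
have cont s : s < ln r' -> forall t, {for t, continuous (P s)}.
  by move=> sr t; apply: cauchy_riemann_continuous_l (CR s t sr).
have s1S : ln rho < ln r' by exact: le_lt_trans s2S.
have Pr t : P (ln r) t <= B.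
  by apply: GB; rewrite mul1r cabs_cexp /= lnK ?posrE.
have Prho t : complex.Re (G z) - e <= P (ln rho) t.
  rewrite /P /H mul1r; set h := cexp _.
  have hrho : cabs h = rho by rewrite cabs_cexp /= lnK ?posrE.
  have := Hd h; rewrite hrho => /(_ rhod); rewrite mul1r => hh.
  have : cabs (G (z + h) - G z) <= e.
    rewrite -(subrK (D * h) (G _ - _)); apply: le_trans (ler_cabsD _ _) _.
    by rewrite cabsM hrho; move: hh rhok; rewrite /k; lra.
  move=> /(le_trans (ler_Re_cabs _)).
  rewrite ler_norml => /andP[+ _].
  have -> : complex.Re (G (z + h) - G z) = complex.Re (G (z + h)) - complex.Re (G z).
    by case: (G _); case: (G _).
  by move: (complex.Re _) (complex.Re _) => x y; lra.
have key : 0 <= B - (complex.Re (G z) - e).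
  rewrite leNgt; apply/negP => neg.
  have iP : (@lebesgue_measure R).-integrable `[0, 2 * pi]
     (EFin \o (fun t => P (ln r) t - P (ln rho) t)).
    apply: continuous_on_integrable => t _.
    by apply: continuousB; apply: cont.
  have ic : (@lebesgue_measure R).-integrable `[0, 2 * pi]
     (EFin \o (fun t : R => B - (complex.Re (G z) - e))).
    by apply: continuous_on_integrable => x _; exact: cvg_cst.
  have : I <= \int[@lebesgue_measure R]_(x in `[0, 2 * pi])
     (B - (complex.Re (G z) - e)).
    apply: le_Rintegral => [//|||t _]; [exact: iP|exact: ic|].
    exact: lerB.
  rewrite I0 Rintegral_segment_cst ?(ltW pi20)// subr0.
  by rewrite pmulr_lge0// leNgt neg.
by move: key; lra.
Qed.

(** A factor of modulus 1 makes the value at z equal to its modulus; the mean value inequality for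
    real parts then applies to the rotated function. *)
Lemma maximum_principle G z (r B : R) : 0 < r ->
  (exists2 r', r < r' & forall h, cabs h < r' -> differentiable G (z + h)) ->
  (forall h, cabs h = r -> cabs (G (z + h)) <= B) -> cabs (G z) <= B.
Proof.
move=> r0 [r' rr' dG] GB.
have [G0|G0] := eqVneq (G z) 0.
  rewrite G0 cabs0; apply: le_trans (GB r%:C%C _); first exact: cabs_ge0.
  by rewrite cabs_real gtr0_norm.
pose l := (cabs (G z))%:C%C / G z.
have l1 : cabs l = 1.
  by rewrite cabsM cabsV cabs_real ger0_norm ?cabs_ge0// divff// gt_eqF// cabs_gt0.
have := @mean_value_le (fun v => l * G v) z r B r0.
rewrite /l divfK//=; apply.
  exists r' => // h hr; have [D dD] := differentiable_cderiv (dG h hr).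
  exists (l * D); apply: (@cderiv_comp G (fun v => l * v)) => //.
  exact: cderiv_scale.
move=> h hr; apply: le_trans (ler_norm _) _; apply: le_trans (ler_Re_cabs _) _.
by rewrite -/l cabsM l1 mul1r; exact: GB.
Qed.

End MaximumPrinciple.

(** * Lifting to covering spaces *)

Section ContinuousOn.

Definition cont_on (S T : topologicalType) (A : set S) (g : S -> T) :=
  forall a, A a -> g @ within A (nbhs a) --> g a.

Lemma cont_onP (S T : topologicalType) (A : set S) (g : S -> T) :
  {within A, continuous g} <-> cont_on A g.
Proof. by split=> [/subspace_continuousP|h]; [|apply/subspace_continuousP]. Qed.

Lemma cont_on_near (S T : topologicalType) (A : set S) (g : S -> T) a V :
  cont_on A g -> A a -> nbhs (g a) V -> \forall x \near a, A x -> V (g x).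
Proof. by move=> cg Aa /(cg _ Aa). Qed.

Lemma cont_on_subset (S T : topologicalType) (A B : set S) (g : S -> T) :
  A `<=` B -> cont_on B g -> cont_on A g.
Proof.
move=> AB cg a Aa V /(cont_on_near cg (AB _ Aa)) h.
by apply: filterS h => x Vx /AB.
Qed.

Lemma cont_on_comp (S T U : topologicalType) (A : set S) (B : set T)
    (f : S -> T) (g : T -> U) :
  cont_on A f -> (forall a, A a -> B (f a)) -> cont_on B g ->
  cont_on A (g \o f).
Proof.
move=> cf AB cg a Aa V /(cont_on_near cg (AB _ Aa)) h.
by have := cont_on_near cf Aa h; apply: filterS => x + Ax; apply; [|exact: AB].
Qed.

Lemma continuous_cont_on (S T : topologicalType) (A : set S) (g : S -> T) :
  continuous g -> cont_on A g.
Proof.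
move=> cg a Aa V /cg h; change (\forall x \near a, A x -> V (g x)).
change (\forall x \near a, V (g x)) in h.
by apply: filterS h => x + _.
Qed.

Lemma cont_on_local (S T : topologicalType) (A : set S) (g : S -> T) :
  (forall a, A a -> exists (B : set S) (h : S -> T), [/\ nbhs a B, A a -> B a,
     cont_on (A `&` B) h & forall x, A x -> B x -> g x = h x]) ->
  cont_on A g.
Proof.
move=> H a Aa V; have [B [h [nB _ ch gh]]] := H a Aa.
have Ba := nbhs_singleton nB.
rewrite (gh a Aa Ba) => /(cont_on_near ch (conj Aa Ba)) hV.
change (\forall x \near a, A x -> V (g x)).
by apply: (filterS2 _ _ nB hV) => x Bx + Ax; rewrite (gh x Ax Bx); apply.
Qed.

End ContinuousOn.

Section SegmentInduction.
Variable R : realType.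

(** At the supremum of the points where [P] holds, the hypothesis carries [P] from a point just
    below it to one just above, unless that supremum is 1. [P] is not assumed monotone, so the step
    starts from some earlier [s1] at which [P] is known. *)
Lemma segment_induction (P : R -> Prop) : P 0 ->
  (forall s, 0 <= s <= 1 -> exists2 e, 0 < e & forall s1 s2,
     0 <= s1 <= s -> s <= s2 <= 1 -> s - e < s1 -> s2 < s + e -> P s1 -> P s2) ->
  P 1.
Proof.
move=> P0 H; pose S := [set s | 0 <= s <= 1 /\ P s].
have S0 : S 0 by split=> //; rewrite lexx ler01.
have hs : has_sup S.
  by split; [exists 0|exists 1 => x [/andP[]]].
pose c := sup S; have c01 : 0 <= c <= 1.
  apply/andP; split; first by apply: ub_le_sup => //; exact: hs.2.
  by apply: ge_sup; [exists 0|move=> x [/andP[]]].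
have [e e0 He] := H c c01.
have [s1 [s101 Ps1] s1c] := sup_adherent e0 hs.
have s1c' : s1 <= c by apply: ub_le_sup; [exact: hs.2|split].
have s1c'' : 0 <= s1 <= c by rewrite s1c' andbT; case/andP: s101.
pose s2 := Num.min 1 (c + e / 2).
have e2 : 0 < e / 2 by rewrite divr_gt0.
have s2P : c <= s2 <= 1.
  by rewrite /s2 le_min ge_min lexx/= andbT; move/andP: c01 => [_ ->]/=; lra.
have Ps2 : P s2.
  apply: (He s1 s2) => //; rewrite /s2 gt_min; apply/orP; right; lra.
have : s2 <= c.
  apply: ub_le_sup; [exact: hs.2|split=> //].
  by move: s2P c01 => /andP[h1 h2] /andP[h3 h4]; rewrite h2 andbT (le_trans h3).
rewrite {1}/s2 ge_min => /orP[c1|]; last by lra.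
suff <- : s2 = 1 by [].
by apply/eqP; rewrite eq_le; move: s2P => /andP[h ->]/=; exact: le_trans h.
Qed.

End SegmentInduction.

(** * Uniqueness of lifts, and their existence over convex sets *)

Section Lifting.
Variables (R : realType) (n : nat) (M : set 'rV[R[i]]_n) (Y : topologicalType).
Variable p : Y -> 'rV[R[i]]_n.
Hypothesis cov : covering_map M p.

Lemma covering_section x : M x -> exists2 W : set 'rV[R[i]]_n, open_nbhs x W &
  forall y, W (p y) -> exists2 s, cont_on W s &
    (forall z, W z -> p (s z) = z) /\ s (p y) = y.
Proof.
have [_ _ cv] := cov; move=> /cv[W [J [s [oW WM cs ps sp]]]].
exists W => // y Wy; have [j [sj _]] := sp y Wy.
by exists (s j); [apply/cont_onP; exact: (cs j).1|split=> // z; exact: ps].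
Qed.

(** Two points of a fibre lie either on one sheet, where [p] is injective, or on disjoint sheets.
    The first case makes the set where two lifts agree relatively open, the second makes it
    relatively closed. *)
Lemma covering_sheets y1 y2 : M (p y1) -> p y1 = p y2 -> exists V1 V2 : set Y,
  [/\ open_nbhs y1 V1, open_nbhs y2 V2,
      y1 = y2 -> forall z1 z2, V1 z1 -> V2 z2 -> p z1 = p z2 -> z1 = z2 &
      y1 <> y2 -> forall z, ~ (V1 z /\ V2 z)].
Proof.
have [_ _ cv] := cov; move=> My p12; have := cv _ My.
move=> [W [J [s [[oW Wy] WM cs ps sp]]]].
have Wy2 : W (p y2) by rewrite -p12.
have [j1 [sj1 u1]] := sp _ Wy; have [j2 [sj2 u2]] := sp _ Wy2.
exists (s j1 @` W), (s j2 @` W).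
have sK j z : (s j @` W) z -> W (p z) /\ s j (p z) = z.
  by move=> [x Wx <-]; rewrite ps.
split.
- by split; [exact: (cs _).2|exists (p y1)].
- by split; [exact: (cs _).2|exists (p y2)].
- move=> y12 z1 z2 /sK[_ e1] /sK[_ e2] pz; rewrite -[LHS]e1 -[RHS]e2 pz.
  by have <- : j1 = j2 by apply: u1; rewrite y12.
- move=> y12 z [/sK[Wz z1] /sK[_ z2]]; apply: y12.
  have [j [_ u]] := sp _ Wz; have jj : j1 = j2 by rewrite -(u _ z1) -(u _ z2).
  by rewrite -sj1 -sj2 jj p12.
Qed.

Lemma lift_unique (T : topologicalType) (A : set T) (g1 g2 : T -> Y) a0 :
  connected A -> cont_on A g1 -> cont_on A g2 ->
  (forall a, A a -> M (p (g1 a)) /\ p (g1 a) = p (g2 a)) ->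
  A a0 -> g1 a0 = g2 a0 -> forall a, A a -> g1 a = g2 a.
Proof.
move=> cA c1 c2 pg Aa0 g0.
suff : [set a | A a /\ g1 a = g2 a] = A.
  by move=> <- a [].
have loc a : A a -> exists V1 V2 : set Y, [/\ nbhs (g1 a) V1, nbhs (g2 a) V2,
    g1 a = g2 a -> forall z1 z2, V1 z1 -> V2 z2 -> p z1 = p z2 -> z1 = z2 &
    g1 a <> g2 a -> forall z, ~ (V1 z /\ V2 z)].
  move=> /pg[Ma pa]; have [V1 [V2 [n1 n2 h1 h2]]] := covering_sheets Ma pa.
  by exists V1, V2; split=> //; exact: open_nbhs_nbhs.
apply: cA; first by exists a0.
(* The lifts are continuous only relative to [A], so the open set witnessing relative openness is
   the interior of an implication whose premise is membership in [A]. *)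
- exists (interior [set x | A x -> g1 x = g2 x]); first exact: open_interior.
  apply/seteqP; split=> [a [Aa ga]|a [Aa /interior_subset/(_ Aa)]//].
  split=> //; have [V1 [V2 [n1 n2 /(_ ga) h _]]] := loc a Aa.
  apply: (filterS2 _ _ (cont_on_near c1 Aa n1) (cont_on_near c2 Aa n2)).
  by move=> x /= h1 h2 Ax; apply: h; [exact: h1|exact: h2|exact: (pg _ Ax).2].
- exists (~` interior [set x | A x -> g1 x <> g2 x]).
    by apply: open_closedC; exact: open_interior.
  apply/seteqP; split=> [a [Aa ga]|a [Aa na]].
    by split=> // /interior_subset /(_ Aa).
  split=> //; apply: contrapT => ga; apply: na.
  have [V1 [V2 [n1 n2 _ /(_ ga) h]]] := loc a Aa.
  apply: (filterS2 _ _ (cont_on_near c1 Aa n1) (cont_on_near c2 Aa n2)).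
  move=> x /= h1 h2 Ax gx; apply: (h (g1 x)); split; first exact: h1.
  by rewrite gx; exact: h2.
Qed.

Section Convex.
Variable k : nat.
Implicit Types (A B : set 'rV[R[i]]_k) (x y v : 'rV[R[i]]_k).

Definition segpt x y (t : R) : 'rV[R[i]]_k := x + t%:C%C *: (y - x).

Definition rconvex A := forall x y t, A x -> A y -> 0 <= t <= 1 ->
  A (segpt x y t).

Definition cball x (e : R) : set 'rV[R[i]]_k :=
  [set y | forall i, cabs (y ord0 i - x ord0 i) < e].

Lemma segpt0 x y : segpt x y 0 = x.
Proof. by rewrite /segpt scale0r addr0. Qed.

Lemma segpt1 x y : segpt x y 1 = y.
Proof. by rewrite /segpt scale1r addrC subrK. Qed.

Lemma segptE x y t i :
  segpt x y t ord0 i = x ord0 i + t%:C%C * (y ord0 i - x ord0 i).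
Proof. by rewrite !mxE. Qed.

Lemma cabs_segptB x y t t' i :
  cabs (segpt x y t ord0 i - segpt x y t' ord0 i) <=
  `|t - t'| * \sum_j cabs (y ord0 j - x ord0 j).
Proof.
rewrite !mxE (_ : _ - _ = (t - t')%:C%C * (y ord0 i - x ord0 i)); last first.
  by rewrite rmorphB/=; ring.
rewrite cabsM cabs_real ler_wpM2l// (bigD1 i)//= lerDl.
by apply: sumr_ge0 => j _; exact: cabs_ge0.
Qed.

Lemma cball_trans x y z e d : cball x e y -> cball y d z -> cball x (e + d) z.
Proof.
move=> xy yz i; rewrite (_ : _ - _ = (y ord0 i - x ord0 i) + (z ord0 i - y ord0 i)).
  by apply: le_lt_trans (ler_cabsD _ _) _; exact: ltrD.
by ring.
Qed.

Lemma open_cball x e : open (cball x e).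
Proof.
rewrite openE => y xy.
have [d d0 yd] : exists2 d, 0 < d & cball x (e - d) y.
  have H i : exists d, 0 < d /\ cabs (y ord0 i - x ord0 i) < e - d.
    exists ((e - cabs (y ord0 i - x ord0 i)) / 2); have := xy i.
    by move: (cabs _) => c ce; split; lra.
  have [d Hd] := choice H.
  exists (\big[Num.min/1]_i d i).
    by apply: lt_bigmin => // i _; exact: (Hd i).1.
  move=> i; apply: lt_le_trans (Hd i).2 _; rewrite lerB//.
  exact: bigmin_le.
apply/nbhs_rV_cabsP; exists d => // z zd.
by have := cball_trans yd zd; rewrite subrK.
Qed.

Lemma cabs_convex (a b : R[i]) (e t : R) : cabs a < e -> cabs b < e ->
  0 <= t <= 1 -> cabs ((1 - t)%:C%C * a + t%:C%C * b) < e.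
Proof.
move=> ae be /andP[t0 t1]; apply: le_lt_trans (ler_cabsD _ _) _.
rewrite !cabsM !cabs_real ger0_norm ?subr_ge0// ger0_norm//.
move: (cabs a) (cabs b) ae be => {}a {}b ae be.
have me : Num.max a b < e by rewrite gt_max ae be.
have am : a <= Num.max a b by rewrite le_max lexx.
have bm : b <= Num.max a b by rewrite le_max lexx orbT.
by move: (Num.max a b) me am bm => m me am bm; nra.
Qed.

Lemma rconvex_cball x e : rconvex (cball x e).
Proof.
move=> y z t xy xz t01 i; rewrite segptE.
rewrite (_ : _ - _ = (1 - t)%:C%C * (y ord0 i - x ord0 i) +
   t%:C%C * (z ord0 i - x ord0 i)); last by rewrite rmorphB/=; ring.
exact: cabs_convex.
Qed.

Lemma rconvexI A B : rconvex A -> rconvex B -> rconvex (A `&` B).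
Proof. by move=> cA cB x y t [? ?] [? ?] t01; split; [apply: cA|apply: cB]. Qed.

Lemma segpt_continuous x y : continuous (segpt x y).
Proof.
move=> t A /nbhs_rV_cabsP[e e0 eA].
pose K := \sum_j cabs (y ord0 j - x ord0 j) + 1.
have K0 : 0 < K.
  by rewrite ltr_wpDl// sumr_ge0// => j _; exact: cabs_ge0.
apply/nbhs_ballP; exists (e / K) => /=; first by rewrite divr_gt0.
move=> t'; rewrite -ball_normE /= distrC ltr_pdivlMr// => tK.
apply: eA => i; apply: le_lt_trans (cabs_segptB _ _ _ _ _) (le_lt_trans _ tK).
by rewrite ler_wpM2l// lerDl.
Qed.

Lemma lift_unique_convex A (g1 g2 : 'rV[R[i]]_k -> Y) a0 :
  rconvex A -> cont_on A g1 -> cont_on A g2 ->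
  (forall a, A a -> M (p (g1 a)) /\ p (g1 a) = p (g2 a)) ->
  A a0 -> g1 a0 = g2 a0 -> forall a, A a -> g1 a = g2 a.
Proof.
move=> cA c1 c2 pg Aa0 g0 a Aa.
have seg t : `[0 : R, 1]%classic t -> A (segpt a0 a t).
  by rewrite /= in_itv /= => t01; exact: cA.
have cs : cont_on `[0 : R, 1] (segpt a0 a).
  by apply: continuous_cont_on; exact: segpt_continuous.
have := @lift_unique _ `[0 : R, 1] (g1 \o segpt a0 a) (g2 \o segpt a0 a) 0
  (@segment_connected _ 0 1) (cont_on_comp cs seg c1) (cont_on_comp cs seg c2).
rewrite /= segpt0 => /(_ (fun t ht => pg _ (seg t ht))) H.
have := H _ g0 1; rewrite segpt1; apply; rewrite /= in_itv /= ?lexx ?ler01//.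
Qed.

Variables (Om : set 'rV[R[i]]_k) (F : 'rV[R[i]]_k -> 'rV[R[i]]_n).
Variables (w0 : 'rV[R[i]]_k) (y0 : Y).
Hypotheses (cOm : rconvex Om) (cF : continuous F).
Hypotheses (FM : forall w, Om w -> M (F w)) (Om0 : Om w0) (y0F : p y0 = F w0).

Let tube w (e s : R) : set 'rV[R[i]]_k :=
  [set y | exists2 t, 0 <= t <= s & cball (segpt w0 w t) e y].

Let rconvex_tube w e s : rconvex (tube w e s).
Proof.
move=> x y r [t ts tx] [t' ts' ty] r01.
exists (t + r * (t' - t)); first by move: ts ts' r01; nra.
move=> i; have E : (t + r * (t' - t))%:C%C = t%:C%C + r%:C%C * (t'%:C%C - t%:C%C) :> R[i].
  by rewrite rmorphD rmorphM rmorphB.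
have := cabs_convex (tx i) (ty i) r01; congr (cabs _ < e).
have alg (X Y' W W0 T T' r' A B C D : R[i]) : A = X + r' * (Y' - X) ->
    B = W0 + T * (W - W0) -> C = W0 + T' * (W - W0) ->
    D = W0 + (T + r' * (T' - T)) * (W - W0) ->
    (1 - r') * (X - B) + r' * (Y' - C) = A - D.
  by move=> -> -> -> ->; ring.
rewrite rmorphB rmorph1; apply: alg; [exact: segptE|exact: segptE|exact: segptE|].
by rewrite -E; exact: segptE.
Qed.

Let open_tube w e s : open (tube w e s).
Proof.
rewrite (_ : tube w e s =
  \bigcup_(t in [set t | 0 <= t <= s]) cball (segpt w0 w t) e).
  by apply: bigcup_open => t _; exact: open_cball.
by apply/seteqP; split=> y [t ts ty]; exists t.
Qed.

Let lifts A (g : 'rV[R[i]]_k -> Y) :=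
  [/\ cont_on A g, forall w, A w -> p (g w) = F w & g w0 = y0].

Let lifts_unique A g1 g2 : rconvex A -> A `<=` Om -> A w0 ->
  lifts A g1 -> lifts A g2 -> forall a, A a -> g1 a = g2 a.
Proof.
move=> cA AO A0 [c1 p1 g10] [c2 p2 g20]; apply: (@lift_unique_convex A _ _ w0) => //.
  by move=> a Aa; rewrite p1 ?p2//; split=> //; apply: FM; exact: AO.
by rewrite g10 g20.
Qed.

(** Segment induction on the length of the tube. Around parameter s a ball is mapped into an evenly
    covered set; the section through the value already reached at [x s1] continues the lift, at the
    price of a thinner tube. *)
Let tube_lift w : Om w ->
  exists2 e : R, 0 < e & exists g, lifts (tube w e 1 `&` Om) g.
Proof.
move=> Ow; pose x t := segpt w0 w t.
have Ox t : 0 <= t <= 1 -> Om (x t) by exact: cOm.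
have local t : 0 <= t <= 1 -> exists (W : set 'rV[R[i]]_n) (d : R),
    [/\ 0 < d, forall v, cball (x t) (d + d) v -> W (F v) &
     forall q : Y, W (p q) -> exists2 s, cont_on W s &
       (forall z, W z -> p (s z) = z) /\ s (p q) = q].
  move=> /Ox/FM/covering_section[W Wn sW].
  have /cF/nbhs_rV_cabsP[d d0 dW] := open_nbhs_nbhs Wn.
  by exists W, (d / 2); split=> // [|v]; [rewrite divr_gt0|rewrite -splitr; exact: dW].
apply: (@segment_induction R
  (fun s => exists2 e : R, 0 < e & exists g, lifts (tube w e s `&` Om) g)).
  have [|W [d [d0 dW sW]]] := local 0; first by rewrite lexx ler01.
  have [|s cs [ps sy]] := sW y0.
    rewrite y0F -(segpt0 w0 w); apply: dW => i.
    by rewrite subrr cabs0 addr_gt0.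
  exists d => //; exists (s \o F).
  have tW v : (tube w d 0 `&` Om) v -> W (F v).
    move=> [[t t0 tv] _]; apply: dW.
    have t00 : t = 0 by apply/eqP; rewrite eq_le andbC.
    by move: tv; rewrite t00 => tv i; apply: lt_trans (tv i) _; rewrite ltrDl.
  split; first by apply: cont_on_comp cs => //; exact: continuous_cont_on.
  - by move=> v /tW /ps.
  - by rewrite /= -y0F.
move=> s s01; have [W [d [d0 dW sW]]] := local s s01.
pose K := \sum_j cabs (w ord0 j - w0 ord0 j) + 1.
have K0 : 0 < K.
  by rewrite ltr_wpDl// sumr_ge0// => j _; exact: cabs_ge0.
have near_x t : `|t - s| < d / K -> cball (x s) d (x t).
  rewrite ltr_pdivlMr// => tK i.
  apply: le_lt_trans (cabs_segptB _ _ _ _ _) (le_lt_trans _ tK).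
  by rewrite ler_wpM2l// lerDl.
exists (d / K); first by rewrite divr_gt0.
move=> s1 s2 /andP[s10 s1s] /andP[ss2 s21] s1d s2d [e1 e10 [g1 [cg1 pg1 g10]]].
have Bx : cball (x s) d (x s1) by apply: near_x; rewrite ltr_norml; lra.
have x1T : (tube w e1 s1 `&` Om) (x s1).
  split; last by apply: Ox; case/andP: s01 => *; lra.
  by exists s1; [rewrite s10 lexx|move=> i; rewrite subrr cabs0].
(* Radius [d + d], because it must contain the balls of radius d about points [x t] that are
   themselves within d of [x s]. *)
pose B := cball (x s) (d + d).
have Bx1 : B (x s1) by move=> i; apply: lt_trans (Bx i) _; rewrite ltrDl.
have [|sec csec [psec secx]] := sW (g1 (x s1)).
  by rewrite pg1//; exact: dW.
have cB : cont_on (B `&` Om) (sec \o F).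
  apply: cont_on_comp csec; first exact: continuous_cont_on.
  by move=> v [/dW].
pose T1 := tube w e1 s1.
(* The overlap is convex and contains [x s1], where the section was chosen to agree with [g1]. *)
have agree v : (T1 `&` Om `&` B) v -> g1 v = sec (F v).
  apply: (@lift_unique_convex _ g1 (sec \o F) (x s1)).
  - apply: rconvexI; last exact: rconvex_cball.
    by apply: rconvexI; [exact: rconvex_tube|exact: cOm].
  - by apply: cont_on_subset cg1 => u [].
  - by apply: cont_on_subset cB => u [[]].
  - move=> a [[Ta Oa] Ba]; rewrite pg1//; split; first exact: FM.
    by rewrite /= psec//; exact: dW.
  - by [].
  - by rewrite /= -{1}secx pg1.
pose e := Num.min e1 d.
have e0 : 0 < e by rewrite lt_min e10.
have cover v : tube w e s2 v -> T1 v \/ B v.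
  move=> [t /andP[t0 ts2] tv]; have [ts1|s1t] := leP t s1; [left|right].
    exists t; first by rewrite t0.
    by move=> i; apply: lt_le_trans (tv i) _; rewrite ge_min lexx.
  have : cball (x s) d (x t) by apply: near_x; rewrite ltr_norml; lra.
  move=> /cball_trans; apply => i; apply: lt_le_trans (tv i) _.
  by rewrite ge_min lexx orbT.
exists e => //; exists (fun v => if `[< T1 v >] then g1 v else sec (F v)).
have inB v : Om v -> B v ->
    (if `[< T1 v >] then g1 v else sec (F v)) = sec (F v).
  by move=> Ov Bv; case: asboolP => // Tv; exact: agree.
split.
- apply: cont_on_local => v [tv Ov]; case: (cover v tv) => [Tv|Bv].
    exists T1, g1; split=> //.
    + by apply: open_nbhs_nbhs; split=> //; exact: open_tube.
    + by apply: cont_on_subset cg1 => u [[]].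
    + by move=> u _ Tu; rewrite asboolT.
  exists B, (sec \o F); split=> //.
  + by apply: open_nbhs_nbhs; split=> //; exact: open_cball.
  + by apply: cont_on_subset cB => u [[]].
  + by move=> u [_ Ou] Bu; exact: inB.
- move=> v [tv Ov]; case: asboolP => Tv; first exact: pg1.
  by rewrite psec//; apply: dW; case: (cover v tv).
- rewrite asboolT//; exists 0; first by rewrite lexx.
  by move=> i; rewrite segpt0 subrr cabs0.
Qed.

(** The value at [w] is read off from a lift along the tube towards [w]. Two such lifts agree on the
    intersection of their tubes, which is convex and contains [w0], so the values fit together
    continuously. *)
Lemma lift_exists : exists ell : 'rV[R[i]]_k -> Y,
  [/\ cont_on Om ell, forall w, Om w -> p (ell w) = F w & ell w0 = y0].
Proof.
have H w : exists eg : R * ('rV[R[i]]_k -> Y), Om w ->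
    0 < eg.1 /\ lifts (tube w eg.1 1 `&` Om) eg.2.
  have [Ow|nOw] := pselect (Om w); last by exists (0, fun=> y0).
  by have [e e0 [g gP]] := tube_lift Ow; exists (e, g).
have [G GP] := choice H.
have T0 w : Om w -> (tube w (G w).1 1 `&` Om) w0.
  move=> Ow; split=> //; exists 0; first by rewrite lexx ler01.
  by move=> i; rewrite segpt0 subrr cabs0; exact: (GP w Ow).1.
have T1 w : Om w -> (tube w (G w).1 1 `&` Om) w.
  move=> Ow; split=> //; exists 1; first by rewrite lexx ler01.
  by move=> i; rewrite segpt1 subrr cabs0; exact: (GP w Ow).1.
have eqG w v : Om w -> Om v -> tube w (G w).1 1 v -> (G v).2 v = (G w).2 v.
  move=> Ow Ov Tv.
  have [e0 [c1 p1 g1]] := GP w Ow; have [e0' [c2 p2 g2]] := GP v Ov.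
  apply: (@lifts_unique
    (tube v (G v).1 1 `&` Om `&` (tube w (G w).1 1 `&` Om))) => //.
  - by apply: rconvexI; (apply: rconvexI; [exact: rconvex_tube|exact: cOm]).
  - by move=> u [[]].
  - by split; exact: T0.
  - by split=> //; [apply: cont_on_subset c2 => u []|move=> u [/p2]].
  - by split=> //; [apply: cont_on_subset c1 => u []|move=> u [_ /p1]].
  - by split; [exact: T1|split].
exists (fun w => (G w).2 w); split.
- apply: cont_on_local => w Ow; exists (tube w (G w).1 1), (G w).2; split.
  + by apply: open_nbhs_nbhs; split; [exact: open_tube|exact: (T1 w Ow).1].
  + by move=> _; exact: (T1 w Ow).1.
  + by have [_ [cg _ _]] := GP w Ow; rewrite setIC.
  + by move=> v Ov Tv; exact: eqG.
- by move=> w Ow; have [_ [_ pg _]] := GP w Ow; apply: pg; exact: T1.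
- by have [_ []] := GP w0 Om0.
Qed.

End Convex.
End Lifting.

(** * Cross-ratios in ordered coordinates *)

Section OnePointLine.
Variable R : realType.
Implicit Types (a b c z : R[i]).

Lemma P1_of_scale c a b : c != 0 -> P1_of (c * a) (c * b) = P1_of a b.
Proof.
move=> c0; rewrite /P1_of mulf_eq0 (negPf c0)/=; case: eqP => // /eqP b0.
by congr Some; rewrite -mulf_div divff// mul1r.
Qed.

Lemma nbhs_P1_None (B : R) : nbhs (None : P1 R)
  [set x | if x is Some z then B < cabs z else True].
Proof.
exists [set z : R[i] | cabs z <= B].
  split; first exact: compact_cdisc.
  by apply: compact_closed; [exact: norm_hausdorff|exact: compact_cdisc].
by move=> x [[z /negP] |->//]; rewrite -ltNge => zB <-.
Qed.

(** If [g x] is nonzero this is continuity of a quotient. Otherwise [f] stays away from 0 while [g]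
    tends to 0, so the quotient leaves every compact set. *)
Lemma P1_of_continuous (T : topologicalType) (f g : T -> R[i]) x :
  f @ x --> f x -> g @ x --> g x -> (f x != 0) || (g x != 0) ->
  (fun t => P1_of (f t) (g t)) @ x --> P1_of (f x) (g x).
Proof.
move=> cf cg; have [gx0|gx0 _] := eqVneq (g x) 0; last first.
  have nz : \forall t \near x, g t != 0.
    have : nbhs (g x) [set y | y != 0].
      apply/nbhs_cabsP; exists (cabs (g x)); first by rewrite cabs_gt0.
      move=> y; apply: contraTneq => ->; rewrite sub0r cabsN ltxx//.
    by move/cg.
  move=> A; rewrite /P1_of (negPf gx0) => nA.
  have FF : Filter (nbhs x) by exact: nbhs_filter.
  have cV : (fun t => (g t)^-1) @ x --> (g x)^-1 by exact: (cvgV gx0 cg).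
  have cfg : (fun t => f t * (g t)^-1) @ x --> f x * (g x)^-1 by exact: (cvgM cf cV).
  have h := cfg _ nA.
  change (\forall t \near x, A (if g t == 0 then None else Some (f t / g t))).
  change (\forall t \near x, A (Some (f t / g t))) in h.
  by apply: (filterS2 _ _ nz h) => t /negPf ->.
rewrite orbF gx0 /P1_of eqxx => fx0 A [K [cK clK] KA].
have [B KB] : exists B : R, forall z, K z -> cabs z <= B.
  have : compact ((@cabs R) @` K).
    apply: continuous_compact => //; apply: continuous_subspaceT.
    exact: cabs_continuous.
  move=> /compact_bounded[M [_ HM]]; exists (M + 1) => z Kz.
  have := HM (M + 1); rewrite ltrDl ltr01 => /(_ isT) /(_ (cabs z)).
  move=> /(_ (ex_intro2 _ _ z Kz erefl)) /=.
  by rewrite ger0_norm ?cabs_ge0.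
have fx1 : 0 < cabs (f x) by rewrite cabs_gt0.
have cf' : \forall t \near x, cabs (f x) / 2 < cabs (f t).
  have : nbhs (f x) [set y | cabs (f x) / 2 < cabs y].
    apply/nbhs_cabsP; exists (cabs (f x) / 2); first by rewrite divr_gt0.
    move=> y /=; have := ler_cabsB (f x) y; rewrite cabs_distC.
    by move: (cabs _) (cabs _) (cabs _) => u v w; lra.
  by move/cf.
pose B' := `|B| + 1.
have B'0 : 0 < B' by rewrite ltr_wpDl.
have cg' : \forall t \near x, cabs (g t) < cabs (f x) / 2 / B'.
  have : nbhs (g x) [set y | cabs y < cabs (f x) / 2 / B'].
    apply/nbhs_cabsP; exists (cabs (f x) / 2 / B'); first by rewrite !divr_gt0.
    by move=> y; rewrite gx0 subr0.
  by move/cg.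
change (\forall t \near x, A (if g t == 0 then None else Some (f t / g t))).
apply: (filterS2 _ _ cf' cg') => t ft gt; apply: KA.
case: eqP => [_|/eqP gt0]; first by right.
left; exists (f t / g t) => // /KB; rewrite cabsM cabsV leNgt => /negP; apply.
have gt1 : 0 < cabs (g t) by rewrite cabs_gt0.
rewrite ltr_pdivlMr//; apply: le_lt_trans ft.
apply: le_trans (_ : B' * cabs (g t) <= _).
  by rewrite ler_wpM2r ?cabs_ge0// /B'; have := ler_norm B; lra.
by rewrite mulrC -ler_pdivlMr// ltW.
Qed.

Lemma P1_separated (u v : P1 R) : u <> v ->
  exists A B, [/\ nbhs u A, nbhs v B & A `&` B = set0].
Proof.
have noneP (y : R[i]) : exists A B,
    [/\ nbhs (None : P1 R) A, nbhs (Some y : P1 R) B & A `&` B = set0].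
  exists [set x | if x is Some z then cabs y + 1 < cabs z else True].
  exists (Some @` [set z | cabs z < cabs y + 1]); split.
  - exact: nbhs_P1_None.
  - apply: one_point_compactification_some_nbhs; apply/nbhs_cabsP; exists 1 => //.
    move=> z /= zy; have := ler_cabsB z y.
    by move: zy; move: (cabs _) (cabs _) (cabs _) => a b c; lra.
  - apply/seteqP; split=> // -[z|] [/= h1 [w h2 //]] [wz].
    by move: h1; rewrite -wz ltNge (ltW h2).
case: u v => [x|] [y|] // uv; last first.
  by have [A [B [nA nB AB]]] := noneP x; exists B, A; split=> //; rewrite setIC.
have xy : x - y != 0 by rewrite subr_eq0; apply/eqP => xy; apply: uv; rewrite xy.
pose e := cabs (x - y) / 2; have e0 : 0 < e by rewrite divr_gt0// cabs_gt0.
exists (Some @` [set z | cabs (z - x) < e]), (Some @` [set z | cabs (z - y) < e]).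
split.
- by apply: one_point_compactification_some_nbhs; apply/nbhs_cabsP; exists e.
- by apply: one_point_compactification_some_nbhs; apply/nbhs_cabsP; exists e.
- apply/seteqP; split=> // _ [[z zx <-] [w wy [wz]]]; move: wy; rewrite wz => zy.
  have := ler_cabsD (x - z) (z - y); rewrite (_ : x - z + (z - y) = x - y); last by ring.
  rewrite (cabs_distC x z); move: zx zy; rewrite /= /e.
  by move: (cabs _) (cabs _) (cabs _) => a b c; lra.
Qed.

End OnePointLine.

(** * Chain coordinates attached to a linear order *)

Section OrderedCoordinates.
Variables (R : realType) (n : nat) (L : n.+1.-tuple (option 'I_n)).
Hypothesis uL : uniq L.
Implicit Types (z t w : 'rV[R[i]]_n) (a b c d : mark n) (x y : nat).

Lemma mem_order o : o \in L.
Proof.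
have cL : #|L| = #|{: option 'I_n}|.
  by rewrite (card_uniqP uL) size_tuple card_option card_ord.
by rewrite (subset_cardP cL (subset_predT _)).
Qed.

Lemma index_order o : (index o L < n.+1)%N.
Proof. by rewrite -[ltnRHS](size_tuple L) index_mem mem_order. Qed.

Definition item x : option 'I_n := nth None L x.

Lemma index_item x : (x < n.+1)%N -> index (item x) L = x.
Proof. by move=> xn; rewrite index_uniq// size_tuple. Qed.

Lemma item_index o : item (index o L) = o.
Proof. by rewrite /item nth_index// mem_order. Qed.

(* Positions in the chain 0, items of L in order, infinity. *)
Definition pos a : nat :=
  match a with
  | Mark0 => 0
  | Mark1 => (index None L).+1
  | MarkInf => n.+2
  | MarkT i => (index (Some i) L).+1
  end.

Definition mark_of (o : option 'I_n) : mark n :=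
  if o is Some i then MarkT i else Mark1 n.

Lemma pos_mark_of o : pos (mark_of o) = (index o L).+1.
Proof. by case: o. Qed.

Lemma pos_le a : (pos a <= n.+2)%N.
Proof.
by case: a => [|||i] //=; rewrite ltnS ltnW// index_order.
Qed.

Lemma pos_inj : injective pos.
Proof.
have iL := index_order.
have ii o o' : index o L = index o' L -> o = o'.
  by move=> h; rewrite -(item_index o) h item_index.
move=> [|||i] [|||j] //= []; try by [move/ii => []].
- by move=> h; have := iL None; rewrite h ltnn.
- by move=> h; have := iL None; rewrite -h ltnn.
- by move=> h; have := iL (Some j); rewrite -h ltnn.
- by move=> h; have := iL (Some i); rewrite h ltnn.
- by move/ii => [->].
Qed.

(* The local coordinates z_1, ..., z_n, extended by 0 to both ends of the chain. *)
Definition zext z (j : nat) : R[i] :=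
  if j is j'.+1 then (if insub j' is Some i then z ord0 i else 0) else 0.

Lemma zextS z (i : 'I_n) : zext z i.+1 = z ord0 i.
Proof. by rewrite /= valK. Qed.

Lemma zext_big z j : (n <= j)%N -> zext z j.+1 = 0.
Proof. by move=> nj /=; rewrite insubF// ltnNge nj. Qed.

Definition zprod z x y : R[i] := \prod_(x <= j < y) zext z j.

Lemma zprod_ge z x y : (y <= x)%N -> zprod z x y = 1.
Proof. by move=> yx; rewrite /zprod big_geq. Qed.

Lemma zprod_eq0 z x y j : (x <= j < y)%N -> zext z j = 0 -> zprod z x y = 0.
Proof.
move=> /andP[xj jy] zj; rewrite /zprod (big_cat_nat _ (n := j))//= 1?ltnW//.
by rewrite [X in _ * X]big_ltn// zj mul0r mulr0.
Qed.

Definition zdiff z x y : R[i] :=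
  if x == y then 0 else
  if (x < y)%N then - (1 - zprod z x y) else 1 - zprod z y x.

Definition zmid (x y x' y' : nat) := minn (maxn x y) (maxn x' y').

(* With p_x the point at position x, (p_x - p_y) = p_(max x y) * zdiff z x y; the
   largest of the four points cancels from a cross-ratio, which leaves the two
   points at positions zmid, whose quotient is a monomial in z. *)
Definition ratio_num z x y x' y' : R[i] :=
  zdiff z x x' * zdiff z y y' * zprod z (zmid x x' y y') (zmid x y' y x').

(** Cross-ratios rewritten in z so that they make sense when coordinates vanish. The tests for
    repeated marks follow [P1_of], where a zero denominator gives infinity whatever the numerator;
    hence that test comes first. *)
Definition corner_map z : ambient R n := fun q : quad n =>
  let: (a, b, c, d) := q in
  if (a == d) || (b == c) then None else
  if (a == c) || (b == d) then Some 0 else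
  P1_of (ratio_num z (pos a) (pos b) (pos c) (pos d))
        (ratio_num z (pos a) (pos b) (pos d) (pos c)).

Local Notation D := (polydisc (fun=> 1 : R)).

Lemma cabs_zext z j : D z -> cabs (zext z j) < 1.
Proof.
move=> Dz; case: j => [|j] /=; first by rewrite cabs0.
by case: insubP => [i _ _|_]; [exact: Dz|rewrite cabs0].
Qed.

Lemma cabs_zprod_le z x y : D z -> cabs (zprod z x y) <= 1.
Proof.
move=> Dz; rewrite cabs_prod.
suff /andP[] : 0 <= \prod_(x <= j < y) cabs (zext z j) <= 1 by [].
apply: (big_ind (fun a : R => 0 <= a <= 1)); rewrite ?ler01 ?lexx//.
  by move=> a b /andP[a0 a1] /andP[b0 b1]; rewrite mulr_ge0// mulr_ile1.
by move=> j _; rewrite cabs_ge0 ltW// cabs_zext.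
Qed.

Lemma cabs_zprod_lt z x y : D z -> (x < y)%N -> cabs (zprod z x y) < 1.
Proof.
move=> Dz xy; rewrite /zprod big_ltn// cabsM.
apply: le_lt_trans (cabs_zext x Dz); rewrite -[leRHS]mulr1.
by rewrite ler_wpM2l ?cabs_ge0// cabs_zprod_le.
Qed.

Lemma zdiff_neq0 z x y : D z -> x != y -> zdiff z x y != 0.
Proof.
move=> Dz xy; have H x' y' : (x' < y')%N -> 1 - zprod z x' y' != 0.
  move=> xy'; rewrite subr_eq0; apply/eqP => h.
  by have := cabs_zprod_lt Dz xy'; rewrite -h cabs1 ltxx.
rewrite /zdiff (negPf xy); case: ltngtP xy => // xy' _; last exact: H.
by rewrite oppr_eq0 H.
Qed.

(** Numerator and denominator carry opposite monomials [zprod z u v] and [zprod z v u], of which at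
    least one is an empty product; the differences never vanish on the polydisc. *)
Lemma ratio_num_neq0 z x y x' y' : D z -> x != x' -> y != y' -> x != y' -> y != x' ->
  (ratio_num z x y x' y' != 0) || (ratio_num z x y y' x' != 0).
Proof.
move=> Dz h1 h2 h3 h4.
case: (leqP (zmid x x' y y') (zmid x y' y x')) => h; apply/orP; [right|left].
  by rewrite !mulf_neq0 ?zdiff_neq0// zprod_ge ?oner_neq0.
by rewrite !mulf_neq0 ?zdiff_neq0// zprod_ge ?oner_neq0// ltnW.
Qed.

Definition item_pt t (o : option 'I_n) : R[i] :=
  if o is Some i then t ord0 i else 1.

Lemma M0n_item_pt t : M0n R n t ->
  (forall o, item_pt t o != 0) /\ injective (item_pt t).
Proof.
move=> [t0 tt]; split=> [[i|]|[i|] [j|]] //=; rewrite ?oner_neq0//.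
- by have [] := t0 i.
- by move=> tij; congr Some; apply/eqP; apply: contraT => /tt; rewrite tij eqxx.
- by move=> ti; have [_] := t0 i; rewrite ti eqxx.
- by move=> ti; have [_] := t0 j; rewrite -ti eqxx.
Qed.

Lemma item_pt_M0n t : (forall o, item_pt t o != 0) -> injective (item_pt t) ->
  M0n R n t.
Proof.
move=> t0 ti; split=> [i|i j ij].
  split; first exact: (t0 (Some i)).
  by apply/eqP => h; have := ti (Some i) None h.
by apply: contraNneq ij => h; have [->] := ti (Some i) (Some j) h.
Qed.

Section CrossRatio.
Variables (t z : 'rV[R[i]]_n).
Hypotheses (t0 : forall o, item_pt t o != 0) (Dz : D z).
Hypothesis tz : forall j : 'I_n,
  item_pt t (item j) = z ord0 j * item_pt t (item j.+1).

(** The point at position x, with 1 in place of 0 and infinity: with homogeneous coordinates (0, 1)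
    and (1, 0) there, and [zext] vanishing at both ends, the bracket formula below holds at all
    positions. *)
Let S x : R[i] := if (0 < x <= n.+1)%N then item_pt t (item x.-1) else 1.

Let S_neq0 x : S x != 0.
Proof. by rewrite /S; case: ifP => _; rewrite ?t0 ?oner_neq0. Qed.

Let S_zprod x y : (0 < x <= y)%N -> (y <= n.+1)%N -> S x = S y * zprod z x y.
Proof.
move=> /andP[x0]; elim: y => [|y IH]; first by rewrite leqNgt x0.
rewrite leq_eqVlt => /predU1P[<- _|xy yn]; first by rewrite zprod_ge// mulr1.
have y0 : (0 < y)%N by exact: leq_trans x0 xy.
have Sy : S y = S y.+1 * zext z y.
  rewrite /S y0 yn (ltnW yn)/=; case: y y0 {IH xy} yn => // y _ yn.
  have yn' : (y < n)%N by rewrite -ltnS.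
  by have := tz (Ordinal yn'); rewrite -zextS mulrC.
by rewrite IH// 1?ltnW// Sy /zprod big_nat_recr//= -mulrA [zext _ _ * _]mulrC.
Qed.

Let crd x : R[i] * R[i] :=
  if x == 0%N then (0, 1) else if x == n.+2 then (1, 0) else (S x, 1).

Let crd_pos a : mark_coord t a = crd (pos a).
Proof.
have H o : crd (index o L).+1 = (item_pt t o, 1).
  by rewrite /crd /= eqSS ltn_eqF ?index_order// /S /= index_order item_index.
by case: a => [|||i] /=; rewrite /crd /= ?eqxx//; [have := H None|have := H (Some i)].
Qed.

Let bracket_lt x y : (x < y <= n.+2)%N ->
  bracket (crd x) (crd y) = - (S y * (1 - zprod z x y)).
Proof.
move=> /andP[xy yn]; have y0 : (y == 0%N) = false by case: (y) xy.
have xn : (x == n.+2) = false by rewrite ltn_eqF// (leq_trans xy).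
rewrite /bracket /crd y0 xn.
have [yn2|yn2] := eqVneq y n.+2.
  rewrite (@zprod_eq0 z x y n.+1); [|by rewrite -ltnS yn2 ltnSn andbT -yn2 |exact: zext_big].
  by rewrite /S yn2 ltnn andbF; case: ifP => _ /=; ring.
have yn1 : (y <= n.+1)%N by move: yn; rewrite leq_eqVlt (negPf yn2).
have [->|x0] := eqVneq x 0%N.
  by rewrite (@zprod_eq0 z 0 y 0) ?lt0n ?y0//=; ring.
by rewrite /= (@S_zprod x y) ?lt0n ?x0 ?(ltnW xy)//=; ring.
Qed.

Let bracket_pos a b : bracket (mark_coord t a) (mark_coord t b) =
  S (maxn (pos a) (pos b)) * zdiff z (pos a) (pos b).
Proof.
rewrite !crd_pos /zdiff; case: ltngtP => xy.
- by rewrite bracket_lt ?xy ?pos_le// mulrN.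
- rewrite (_ : bracket _ _ = - bracket (crd (pos b)) (crd (pos a))).
    by rewrite bracket_lt ?xy ?pos_le// opprK.
  by rewrite /bracket; ring.
- by rewrite mulr0 xy /bracket subrr.
Qed.

Lemma cross_ratio_corner : cross_ratio t = corner_map z.
Proof.
apply/funext => -[[[a b] c] d]; rewrite /cross_ratio /corner_map !bracket_pos.
have posE u v : (pos u == pos v) = (u == v) by rewrite (inj_eq pos_inj).
have U0 x : zdiff z x x = 0 by rewrite /zdiff eqxx.
have [ad|ad] := eqVneq a d; first by rewrite ad U0 mulr0 mul0r /P1_of eqxx.
have [bc|bc] := eqVneq b c; first by rewrite bc U0 !mulr0 /P1_of eqxx.
have den0 : S (maxn (pos a) (pos d)) * zdiff z (pos a) (pos d) *
    (S (maxn (pos b) (pos c)) * zdiff z (pos b) (pos c)) != 0.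
  by rewrite !mulf_neq0// zdiff_neq0// posE.
have [ac|ac] := eqVneq a c.
  by rewrite /= /P1_of (negPf den0) ac U0 mulr0 !mul0r.
have [bd|bd] := eqVneq b d.
  by rewrite /= /P1_of (negPf den0) bd U0 !mulr0 mul0r.
move=> {den0} /=; rewrite -!posE in ad bc ac bd.
move: (pos_le a) (pos_le b) (pos_le c) (pos_le d).
move: (pos a) (pos b) (pos c) (pos d) ad bc ac bd => al be ga de ad bc ac bd aN bN cN dN.
rewrite /ratio_num; set x := zmid al ga be de; set y := zmid al de be ga.
(* Applied to the two maxima in a product of brackets, this isolates the largest of the four
   positions, common to numerator and denominator, and leaves the one given by [zmid]. *)
have SS u v : S u * S v = S (maxn u v) * S (minn u v).
  by case: (leqP u v) => _ //; rewrite mulrC.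
pose mu := maxn (maxn al be) (maxn ga de).
have mu1 : maxn (maxn al ga) (maxn be de) = mu by rewrite /mu; lia.
have mu2 : maxn (maxn al de) (maxn be ga) = mu by rewrite /mu; lia.
have E1 : S (maxn al ga) * zdiff z al ga * (S (maxn be de) * zdiff z be de) =
    S mu * (S x * (zdiff z al ga * zdiff z be de)).
  by rewrite mulrACA SS mu1 -mulrA.
have E2 : S (maxn al de) * zdiff z al de * (S (maxn be ga) * zdiff z be ga) =
    S mu * (S y * (zdiff z al de * zdiff z be ga)).
  by rewrite mulrACA SS mu2 -mulrA.
rewrite E1 E2 P1_of_scale//.
(* The quotient of the points at x and y is a monomial that belongs in the numerator or in the
   denominator according to which position comes first. *)
have [xy|yx|xy] := ltngtP x y.
- have Sx : S x = S y * zprod z x y.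
    by apply: S_zprod; move: xy; rewrite /x /y /zmid; lia.
  rewrite Sx -mulrA P1_of_scale// (@zprod_ge z y x) ?(ltnW xy)// mulr1.
  by rewrite mulrC.
- have Sy : S y = S x * zprod z y x.
    by apply: S_zprod; move: yx; rewrite /x /y /zmid; lia.
  rewrite Sy -mulrA P1_of_scale// (@zprod_ge z x y) ?(ltnW yx)// mulr1.
  by rewrite [X in P1_of _ X]mulrC.
- by rewrite xy P1_of_scale// zprod_ge// !mulr1.
Qed.

End CrossRatio.

(** Against 0 and infinity the cross-ratio of two points is their quotient, so these cross-ratios
    are the chart coordinates. The index j counts from 0: item j stands at position j + 1. *)
Definition coord_quad (j : nat) : quad n :=
  (mark_of (item j), mark_of (item j.+1), Mark0 n, MarkInf n).

Lemma cross_ratio_coord t (j : nat) :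
  item_pt t (item j.+1) != 0 ->
  cross_ratio t (coord_quad j) = Some (item_pt t (item j) / item_pt t (item j.+1)).
Proof.
have mE o : mark_coord t (mark_of o) = (item_pt t o, 1) by case: o.
move=> h; rewrite /cross_ratio /coord_quad !mE /bracket /=.
rewrite !(mulr0, mulr1, mul0r, mul1r, subr0, sub0r) mulrN1 mulN1r.
by rewrite /P1_of oppr_eq0 (negPf h) invrN mulrNN.
Qed.

Lemma zdiff_lt z x y : (x < y)%N -> zdiff z x y = - (1 - zprod z x y).
Proof. by move=> xy; rewrite /zdiff xy ltn_eqF. Qed.

Lemma zdiff_gt z x y : (y < x)%N -> zdiff z x y = 1 - zprod z y x.
Proof. by move=> yx; rewrite /zdiff gtn_eqF// ltnNge ltnW. Qed.

Lemma zdiff_x0 z x : zdiff z x.+1 0 = 1.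
Proof. by rewrite zdiff_gt// (@zprod_eq0 z 0 x.+1 0)// subr0. Qed.

Lemma zdiff_0x z x : zdiff z 0 x.+1 = -1.
Proof. by rewrite zdiff_lt// (@zprod_eq0 z 0 x.+1 0)// subr0. Qed.

Lemma zdiff_xinf z x : (x < n.+2)%N -> zdiff z x n.+2 = -1.
Proof.
move=> xn; rewrite zdiff_lt// (@zprod_eq0 z x n.+2 n.+1) ?subr0//.
  by rewrite ltnSn andbT -ltnS.
exact: zext_big.
Qed.

Lemma corner_map_coord z (j : 'I_n) : corner_map z (coord_quad j) = Some (z ord0 j).
Proof.
have jn : (j < n)%N by [].
have pj : pos (mark_of (item j)) = j.+1.
  by rewrite pos_mark_of index_item// ltnW.
have pj1 : pos (mark_of (item j.+1)) = j.+2.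
  by rewrite pos_mark_of index_item.
rewrite /corner_map /coord_quad -!(inj_eq pos_inj) pj pj1 /=.
have -> : (j.+1 == n.+2) = false by apply/eqP; lia.
have -> : (j.+2 == n.+2) = false by apply/eqP; lia.
rewrite /ratio_num !zdiff_x0 !zdiff_xinf ?ltnS// 1?ltnW//.
have -> : zmid j.+1 0 j.+2 n.+2 = j.+1 by rewrite /zmid; lia.
have -> : zmid j.+1 n.+2 j.+2 0 = j.+2 by rewrite /zmid; lia.
rewrite (@zprod_ge z j.+2 j.+1)// /zprod big_nat1 zextS /=.
rewrite /P1_of !mulr1 oppr_eq0 oner_eq0; congr Some.
by rewrite invrN invr1 mul1r mulrN1 mulN1r opprK.
Qed.

Lemma corner_map_inj z z' : corner_map z = corner_map z' -> z = z'.
Proof.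
move=> zz'; apply/rowP => j.
have := corner_map_coord z j; rewrite zz' corner_map_coord.
by move=> [] ->.
Qed.

(** The cross-ratio of 0, item j, item j + 1 and infinity is 1 / (1 - z_j), equal to 1 only for z_j
    = 0. Conversely z_j = 0 kills every monomial that crosses the cut, so all differences across it
    are -1. *)
Lemma corner_map_divisor z (j : 'I_n) : D z ->
  (forall a b c d, (pos a <= j.+1)%N -> (pos b <= j.+1)%N ->
     (j.+1 < pos c)%N -> (j.+1 < pos d)%N ->
     corner_map z (a, b, c, d) = Some 1) <-> z ord0 j = 0.
Proof.
move=> Dz; have jn : (j < n)%N by []; split=> [H|zj a b c d aj bj cj dj].
  have pj : pos (mark_of (item j)) = j.+1.
    by rewrite pos_mark_of index_item// ltnW.
  have pj1 : pos (mark_of (item j.+1)) = j.+2.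
    by rewrite pos_mark_of index_item.
  have := H (Mark0 n) (mark_of (item j)) (mark_of (item j.+1)) (MarkInf n).
  rewrite pj pj1 => /(_ isT (leqnn _) (leqnn _)); rewrite /= ltnS => /(_ (ltnW jn)).
  rewrite /corner_map -!(inj_eq pos_inj) pj pj1 /=.
  have -> : (j.+1 == j.+2) = false by apply/eqP; lia.
  have -> : (j.+1 == n.+2) = false by apply/eqP; lia.
  rewrite /ratio_num !zdiff_0x !zdiff_xinf ?ltnS// 1?ltnW// zdiff_lt//.
  have -> : zmid 0 j.+2 j.+1 n.+2 = j.+2 by rewrite /zmid; lia.
  have -> : zmid 0 n.+2 j.+1 j.+2 = j.+2 by rewrite /zmid; lia.
  rewrite (@zprod_ge z j.+2 j.+2)// /zprod big_nat1 zextS.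
  rewrite !mulrNN !mulr1 mul1r /P1_of.
  case: eqP => // /eqP zj0 [] /(congr1 (fun u => u * (1 - z ord0 j))).
  rewrite divfK// mul1r => /eqP; rewrite eq_sym subr_eq addrC -subr_eq subrr.
  by move=> /eqP <-.
rewrite /corner_map -!(inj_eq pos_inj).
have lt u v : (u <= j.+1)%N -> (j.+1 < v)%N -> (u < v)%N by exact: leq_ltn_trans.
rewrite (ltn_eqF (lt _ _ aj dj)) (ltn_eqF (lt _ _ bj cj)).
rewrite (ltn_eqF (lt _ _ aj cj)) (ltn_eqF (lt _ _ bj dj)) /=.
have zd u v : (u <= j.+1)%N -> (j.+1 < v)%N -> zdiff z u v = -1.
  move=> uj vj; rewrite /zdiff (ltn_eqF (lt _ _ uj vj)) (lt _ _ uj vj).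
  by rewrite (@zprod_eq0 z u v j.+1) ?uj// ?zextS// subr0.
rewrite /ratio_num !zd// mulrNN mulr1.
have -> : zmid (pos a) (pos d) (pos b) (pos c) =
    zmid (pos a) (pos c) (pos b) (pos d) by rewrite /zmid; lia.
by rewrite zprod_ge// mulr1 /P1_of oner_eq0 divr1.
Qed.

End OrderedCoordinates.

(** * The chart at a maximally degenerate curve *)

Section CornerChart.
Variables (R : realType) (n : nat) (L : n.+1.-tuple (option 'I_n)).
Hypothesis uL : uniq L.
Implicit Types (z t w : 'rV[R[i]]_n) (q : quad n).

Local Notation D := (polydisc (fun=> 1 : R)).
Local Notation pos := (pos L).
Local Notation item := (item L).
Local Notation corner_map := (corner_map L).

Lemma differentiable_prod (T : Type) (s : seq T) (f : T -> 'rV[R[i]]_n -> R[i]) z :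
  (forall j, differentiable (f j) z) ->
  differentiable (fun z => \prod_(j <- s) f j z) z.
Proof.
move=> df; elim: s => [|j s IH].
  rewrite (_ : (fun _ => _) = cst 1); first exact: differentiable_cst.
  by apply/funext => u; rewrite big_nil.
rewrite (_ : (fun _ => _) = f j * (fun z => \prod_(j <- s) f j z)).
  exact: differentiableM.
by apply/funext => u; rewrite big_cons.
Qed.

Lemma differentiable_zext j z : differentiable (zext (n := n) ^~ j) z.
Proof.
case: j => [|j]; first exact: differentiable_cst.
rewrite /zext; case: insubP => [i _ _|_]; first exact: differentiable_coord.
exact: differentiable_cst.
Qed.

Lemma differentiable_zprod x y z : differentiable (fun z => zprod z x y) z.
Proof. by apply: differentiable_prod => j; exact: differentiable_zext. Qed.

Lemma differentiable_zdiff x y z : differentiable (fun z => zdiff z x y) z.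
Proof.
have d u v : differentiable (fun z => 1 - zprod z u v) z.
  rewrite (_ : (fun _ => _) = (cst 1 : 'rV[R[i]]_n -> R[i]) - (fun z => zprod z u v)).
    apply: differentiableB; last exact: differentiable_zprod.
    exact: differentiable_cst.
  by apply/funext.
rewrite /zdiff; case: eqP => _; first exact: differentiable_cst.
case: ltnP => _; last exact: d.
exact: (@differentiableN _ _ _ (fun z => 1 - zprod z x y)).
Qed.

Lemma differentiable_ratio_num x y x' y' z :
  differentiable (fun z => ratio_num z x y x' y') z.
Proof.
apply: (@differentiableM _ _ (fun z => zdiff z x x' * zdiff z y y')).
  apply: (@differentiableM _ _ (fun z => zdiff z x x')).
    exact: differentiable_zdiff.
  exact: differentiable_zdiff.
exact: differentiable_zprod.
Qed.

Lemma open_polydisc : open (D : set 'rV[R[i]]_n).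
Proof.
rewrite (_ : D = cball 0 1); first exact: open_cball.
by apply/seteqP; split=> z Dz i; have := Dz i; rewrite mxE subr0.
Qed.

Lemma nbhs_forall (T : topologicalType) (I : finType) (x : T) (P : I -> T -> Prop) :
  (forall i, nbhs x (P i)) -> nbhs x (fun y => forall i, P i y).
Proof. by move=> H; exact: (@filter_forall T I P (nbhs x) _ H). Qed.

Lemma near_all (P : 'rV[R[i]]_n -> Prop) z : (forall w, P w) -> \forall w \near z, P w.
Proof. by move=> h; apply/nbhs_rV_cabsP; exists 1. Qed.

Lemma corner_map_holomorphic q : holomorphic_P1 D (fun z => corner_map z q).
Proof.
case: q => [[[a b] c] d] z Dz; rewrite /corner_map.
have dc (k : R[i]) u : differentiable (cst k : 'rV[R[i]]_n -> R[i]) u.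
  exact: differentiable_cst.
have [h|/norP[ad bc]] := boolP ((a == d) || (b == c)).
  exists (cst 1), (cst 0); apply: near_all => w; split=> //.
    by rewrite oner_eq0.
  by rewrite /P1_of eqxx.
have [h|/norP[ac bd]] := boolP ((a == c) || (b == d)).
  exists (cst 0), (cst 1); apply: near_all => w; split=> //.
    by rewrite oner_eq0 orbT.
  by rewrite /P1_of oner_eq0 mul0r.
exists (fun z => ratio_num z (pos a) (pos b) (pos c) (pos d)).
exists (fun z => ratio_num z (pos a) (pos b) (pos d) (pos c)).
have nD : nbhs z D by apply: open_nbhs_nbhs; split=> //; exact: open_polydisc.
apply: filterS nD => w Dw; split; last by [].
- exact: differentiable_ratio_num.
- exact: differentiable_ratio_num.
- by apply: ratio_num_neq0 => //; rewrite (inj_eq (pos_inj uL)).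
Qed.

Lemma corner_map_cvg z : D z -> corner_map x @[x --> z] --> corner_map z.
Proof.
move=> Dz; have cq q : (fun x => corner_map x q) @ z --> corner_map z q.
  have cc (u : P1 R) : (fun _ : 'rV[R[i]]_n => u) @ z --> u.
    by move=> A /nbhs_singleton Au; apply: near_all.
  case: q => [[[a b] c] d]; rewrite /corner_map.
  have [h|/norP[ad bc]] := boolP ((a == d) || (b == c)); first exact: cc.
  have [h|/norP[ac bd]] := boolP ((a == c) || (b == d)); first exact: cc.
  apply: P1_of_continuous.
  - exact: (differentiable_continuous (differentiable_ratio_num _ _ _ _ z)).
  - exact: (differentiable_continuous (differentiable_ratio_num _ _ _ _ z)).
  - by apply: ratio_num_neq0 => //; rewrite (inj_eq (pos_inj uL)).
have FF : Filter (corner_map x @[x --> z]) by apply: fmap_filter; exact: nbhs_filter.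
apply/cvg_sup => q U [V] [[W] oW <-] WfN WU.
have : nbhs (corner_map z q) W by apply: open_nbhs_nbhs.
by move/(cq q) => h; apply: (filterS WU).
Qed.

(** As w_j is the logarithm of the quotient of items j and j + 1, this is the logarithm of item x
    relative to item 0. Subtracting the value at [None] in [log_point] normalises the mark 1 to the
    point 1. *)
Definition log_pos w (x : nat) : R[i] := - \sum_(j < n | (j < x)%N) w ord0 j.

Definition log_point w : 'rV[R[i]]_n :=
  \row_i cexp (log_pos w (index (Some i) L) - log_pos w (index None L)).

Lemma item_pt_log_point w u : item_pt (log_point w) u =
  cexp (log_pos w (index u L) - log_pos w (index None L)).
Proof. by case: u => [i|] /=; rewrite ?mxE// subrr cexp0. Qed.

Lemma log_posS w (j : 'I_n) : log_pos w j = w ord0 j + log_pos w j.+1.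
Proof.
rewrite /log_pos [in RHS](bigD1 j)//= opprD addrA subrr sub0r; congr (- _).
by apply: eq_bigl => i; rewrite ltnS ltn_neqAle andbC.
Qed.

Lemma item_pt_log_point_ratio w (j : 'I_n) : item_pt (log_point w) (item j) =
  cexp (w ord0 j) * item_pt (log_point w) (item j.+1).
Proof.
have jn : (j < n)%N by [].
rewrite !item_pt_log_point !index_item// ?ltnS 1?ltnW// -cexpD.
by rewrite log_posS addrA.
Qed.

(** The real parts of the w_j are negative, so the moduli increase strictly along the chain and the
    points are distinct. *)
Lemma log_point_M0n w : log_domain n (fun=> 1) w -> M0n R n (log_point w).
Proof.
move=> Dw; have neg j : complex.Re (w ord0 j) < 0.
  have := Dw j; rewrite mxE ltn_ord cabs_cexp => h.
  by rewrite -ltr_expR expR0.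
apply: item_pt_M0n => [u|u v]; first by rewrite item_pt_log_point cexp_neq0.
rewrite !item_pt_log_point => /(congr1 (@cabs R)); rewrite !cabs_cexp => /expR_inj.
have ReB (a b : R[i]) : complex.Re (a - b) = complex.Re a - complex.Re b.
  by case: a; case: b.
rewrite !ReB => /addIr.
have mono x y : (x < y <= n)%N ->
    complex.Re (log_pos w x) < complex.Re (log_pos w y).
  move=> /andP[]; elim: y => [//|y IH]; rewrite ltnS leq_eqVlt => xy yn.
  have S : complex.Re (log_pos w y) < complex.Re (log_pos w y.+1).
    have := log_posS w (Ordinal yn) => /= ->.
    have := neg (Ordinal yn); move: (w _ _) (log_pos _ _) => [a b] [c d] /=; lra.
  by case/predU1P: xy => [->//|xy]; apply: lt_trans S; apply: IH => //; exact: ltnW.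
have io k : (index k L <= n)%N by rewrite -ltnS; exact: index_order.
move=> E; rewrite -(item_index uL u) -(item_index uL v).
case: (ltngtP (index u L) (index v L)) => [h|h|-> //].
  by have := mono (index u L) (index v L); rewrite h io E ltxx => /(_ isT).
by have := mono (index v L) (index u L); rewrite h io E ltxx => /(_ isT).
Qed.

Lemma cross_ratio_log_point w : log_domain n (fun=> 1) w ->
  cross_ratio (log_point w) = corner_map (from_log n w).
Proof.
move=> Dw; apply: cross_ratio_corner => //.
  by move=> u; rewrite item_pt_log_point cexp_neq0.
by move=> j; rewrite item_pt_log_point_ratio mxE ltn_ord.
Qed.

Lemma from_log_surj z : D z -> (forall i, z ord0 i != 0) ->
  exists2 w, log_domain n (fun=> 1) w & from_log n w = z.
Proof.
move=> Dz z0; have H i := cexp_surj (z0 i); have [w wP] := choice H.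
have E : from_log n (\row_i w i) = z.
  by apply/rowP => i; rewrite !mxE ltn_ord wP.
by exists (\row_i w i) => //; rewrite /log_domain /= E.
Qed.

Lemma corner_map_interior z : D z -> (forall i, z ord0 i != 0) ->
  exists2 t, M0n R n t & cross_ratio t = corner_map z.
Proof.
move=> Dz z0; have [w Dw <-] := from_log_surj Dz z0.
by exists (log_point w); [exact: log_point_M0n|exact: cross_ratio_log_point].
Qed.

(** Replacing the zero coordinates by a small positive number gives nearby points in the image of
    the open moduli space. *)
Lemma corner_map_Mbar z : D z -> Mbar R n (corner_map z).
Proof.
move=> Dz A nA; have : \forall x \near z, A (corner_map x) by exact: corner_map_cvg.
have nD : nbhs z D by apply: open_nbhs_nbhs; split=> //; exact: open_polydisc.
move=> nA'; have /nbhs_rV_cabsP[e e0 eP] : nbhs z [set x | D x /\ A (corner_map x)].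
  exact: filterI.
pose z' : 'rV[R[i]]_n := \row_i (if z ord0 i == 0 then (e / 2)%:C%C else z ord0 i).
have [Dz' Az'] : D z' /\ A (corner_map z').
  apply: eP => i; rewrite mxE; case: eqP => [->|_]; last by rewrite subrr cabs0.
  rewrite subr0 cabs_real gtr0_norm ?divr_gt0//.
  by rewrite ltr_pdivrMr// ltr_pMr// ltr1n.
have z'0 i : z' ord0 i != 0.
  rewrite mxE; have [_|//] := eqVneq (z ord0 i) 0.
  by rewrite -cabs_gt0 cabs_real gtr0_norm divr_gt0.
have [t tM tE] := corner_map_interior Dz' z'0.
by exists (corner_map z'); split=> //; exists t.
Qed.

Lemma corner_map_boundary z : D z ->
  boundary R n (corner_map z) <-> exists2 i : 'I_n, (i < n)%N & z ord0 i = 0.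
Proof.
move=> Dz; split=> [[_ nI]|[i _ zi]].
  apply: contrapT => nz; apply: nI.
  have [|t tM tE] := corner_map_interior Dz; last by exists t.
  by move=> i; apply/eqP => zi; apply: nz; exists i.
split; first exact: corner_map_Mbar.
move=> [t /M0n_item_pt[t0 _] tz].
have := @cross_ratio_coord R n L t i (t0 _).
rewrite tz corner_map_coord// zi => -[/esym/eqP].
by rewrite mulf_eq0 invr_eq0 !(negPf (t0 _)).
Qed.

(** The coordinates determine a point of the closure. If [x] and [corner_map z] differed at a
    quadruple q, separate their values there: a point of the open moduli space close to [x], both at
    q and in the coordinates, is [corner_map w] with w near z, so its value at q would lie in both
    disjoint neighbourhoods. *)
Lemma corner_map_surj (x : ambient R n) : Mbar R n x ->
  (forall j : 'I_n, exists2 u : R[i], cabs u < 1 & x (coord_quad L j) = Some u) ->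
  exists2 z, D z & corner_map z = x.
Proof.
move=> Mx xj; have H (j : 'I_n) : exists u : R[i], cabs u < 1 /\ x (coord_quad L j) = Some u.
  by have [u] := xj j; exists u.
have [zf zP] := choice H; pose z : 'rV[R[i]]_n := \row_j zf j.
have Dz : D z by move=> i; rewrite mxE; exact: (zP i).1.
exists z => //; apply: contrapT => zx.
have [q qx] : exists q, corner_map z q <> x q.
  by apply: contrapT => h; apply: zx; apply/funext => q; apply: contrapT => hq; apply: h; exists q.
have [A [B [nA nB AB]]] := P1_separated qx.
have nA' : \forall w \near z, A (corner_map w q).
  have := corner_map_cvg Dz.
  have pc : {for (corner_map z : prod_topology (fun _ : quad n => P1 R)),
     continuous (fun y : prod_topology (fun _ : quad n => P1 R) => y q)}.
    exact: (@proj_continuous (quad n) (fun=> P1 R) q).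
  by move=> h; exact: (h _ (pc _ nA)).
have nD : nbhs z D by apply: open_nbhs_nbhs; split=> //; exact: open_polydisc.
have /nbhs_rV_cabsP[e e0 eP] : nbhs z [set w | D w /\ A (corner_map w q)].
  exact: filterI.
have nbx (p : quad n) (C : set (P1 R)) : nbhs (x p) C -> nbhs x [set y : ambient R n | C (y p)].
  move=> nC; exact: (@proj_continuous (quad n) (fun=> P1 R) p x C nC).
have nE : nbhs x [set y : ambient R n | forall j : 'I_n,
    (Some @` [set u | cabs (u - z ord0 j) < e]) (y (coord_quad L j))].
  apply: (@nbhs_forall (ambient R n)) => j; apply: nbx; rewrite (zP j).2 mxE.
  apply: one_point_compactification_some_nbhs.
  by apply/nbhs_cabsP; exists e.
have [_ [[t tM <-] [Bt tE]]] := Mx _ (filterI (nbx q B nB) nE).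
have [t0 _] := M0n_item_pt tM.
pose w : 'rV[R[i]]_n := \row_j (item_pt t (item j) / item_pt t (item j.+1)).
have we j : cabs (w ord0 j - z ord0 j) < e.
  have [u ue] := tE j; rewrite cross_ratio_coord ?t0// => -[uw].
  by rewrite [w _ _]mxE -uw.
have [Dw Aw] := eP w we.
suff tw : cross_ratio t = corner_map w.
  have : (A `&` B) (cross_ratio t q) by split=> //; rewrite tw.
  by rewrite AB.
apply: cross_ratio_corner => // j.
by rewrite mxE divfK.
Qed.

Lemma corner_chart : chart n (fun=> 1 : R) corner_map.
Proof.
split.
- by split=> // i.
- exact: corner_map_holomorphic.
- by move=> z z' _ _; exact: corner_map_inj.
- exists [set x : ambient R n | forall j : 'I_n,
    (Some @` [set u : R[i] | cabs u < 1]) (x (coord_quad L j))].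
    rewrite openE => x xO; apply: (@nbhs_forall (ambient R n)) => j.
    apply: (@proj_continuous (quad n) (fun=> P1 R) (coord_quad L j) x).
    apply: open_nbhs_nbhs; split; last exact: xO.
    apply: one_point_compactification_open_some.
    by apply: (@open_comp _ _ (@cabs R) [set x | x < 1]);
      [move=> u _; exact: cabs_continuous|exact: open_lt].
  apply/seteqP; split=> [_ [z Dz <-]|x [Mx xO]].
    split; first exact: corner_map_Mbar.
    by move=> j; rewrite corner_map_coord//; exists (z ord0 j) => //; exact: Dz.
  have [|z Dz zx] := corner_map_surj Mx; last by exists z.
  by move=> j; have [u u1 ux] := xO j; exists u.
- by move=> z Dz; exact: corner_map_boundary.
Qed.

Definition initial_items (j : nat) : {set 'I_n} :=
  finset (fun i : 'I_n => (index (Some i) L <= j)%N).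

(** For j before the place of 1 in the order, the mark 1 falls on the side of infinity when z_j = 0,
    and this is what type 0 demands. *)
Lemma divisor_type0_corner (j : 'I_n) z : (j < index None L)%N -> D z ->
  divisor_type0 R (initial_items j) (corner_map z) <->
  z ord0 j = 0.
Proof.
move=> jN Dz; set I := initial_items j.
have SP a : (a = Mark0 n \/ exists2 k, k \in I & a = MarkT k) <->
    (pos a <= j.+1)%N.
  case: a => [|||i] /=; split=> //.
  - by left.
  - by move=> [//|[]].
  - by rewrite ltnS leqNgt jN.
  - by move=> [//|[]].
  - by rewrite !ltnS leqNgt ltnS (ltnW (ltn_ord j)).
  - by move=> [//|[k + [->]]]; rewrite inE ltnS.
  - by rewrite ltnS => ij; right; exists i; rewrite ?inE.
rewrite -(corner_map_divisor uL j Dz); split=> [[_ H] a b c d aj bj cj dj|H].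
  apply: H; [exact/SP|exact/SP|..]; move/SP; by rewrite leqNgt ?cj ?dj.
split; first exact: corner_map_Mbar.
move=> a b c d /SP aj /SP bj nc nd; apply: H => //; rewrite ltnNge.
  by apply/negP => /SP.
by apply/negP => /SP.
Qed.

(** The items 0, ..., j do not include 1, so all j + 1 of them are variables; this is the
    multiplicity of z_j, with j counted from 0. *)
Lemma card_initial_items (j : nat) : (j < index None L)%N ->
  #|initial_items j| = j.+1.
Proof.
move=> jN; have Nn : (index None L < n.+1)%N by exact: index_order.
have jn : (j.+1 <= n.+1)%N by apply: ltnW; exact: leq_ltn_trans Nn.
have ui : {in initial_items j &,
    injective (fun i : 'I_n => inord (index (Some i) L) : 'I_j.+1)}.
  move=> i i'; rewrite !inE => ij i'j /(congr1 (@nat_of_ord _)).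
  rewrite !inordK// => h.
  by have := item_index uL (Some i); rewrite h item_index// => -[].
rewrite -(card_in_imset ui) -[RHS]card_ord; apply: eq_card => k.
rewrite inE; apply/imsetP.
have kN : (k < index None L)%N by apply: leq_ltn_trans jN; rewrite -ltnS.
have kn : (k < n.+1)%N by exact: ltn_trans Nn.
have := index_item uL kn; case E : (item k) => [i|] h.
  exists i; first by rewrite inE h -ltnS.
  by apply: val_inj; rewrite /= h inordK.
by move: kN; rewrite -h ltnn.
Qed.

Lemma log_point_continuous : continuous log_point.
Proof.
move=> w; have cV x : (fun w => log_pos w x) @ w --> log_pos w x.
  move=> A /nbhs_cabsP[e e0 eA]; apply/nbhs_rV_cabsP.
  exists (e / n.+1%:R); first by rewrite divr_gt0.
  move=> v vw; apply: eA; rewrite /log_pos -opprD cabsN -sumrB.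
  apply: le_lt_trans (ler_cabs_sum _ _ _) _.
  apply: (@le_lt_trans _ _ (\sum_(j < n) e / n.+1%:R)).
    rewrite big_mkcond; apply: ler_sum => j _; case: ifP => _.
      by rewrite ltW.
    by rewrite divr_ge0// ltW.
  rewrite sumr_const card_ord -[_ *+ n]mulr_natr mulrAC ltr_pdivrMr//.
  by rewrite ltr_pM2l// ltr_nat.
move=> A /nbhs_rV_cabsP[e e0 eA].
have H i : \forall v \near w, cabs (log_point v ord0 i - log_point w ord0 i) < e.
  have cB : (fun w => log_pos w (index (Some i) L) - log_pos w (index None L)) @ w -->
      log_pos w (index (Some i) L) - log_pos w (index None L).
    exact: (cvgB (cV _) (cV _)).
  have : nbhs (cexp (log_pos w (index (Some i) L) - log_pos w (index None L)))
     [set u | cabs (u - cexp (log_pos w (index (Some i) L) - log_pos w (index None L))) < e].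
    by apply/nbhs_cabsP; exists e.
  move=> /cexp_continuous /cB h.
  have h' : nbhs w (fun v : 'rV[R[i]]_n =>
    cabs (cexp (log_pos v (index (Some i) L) - log_pos v (index None L)) -
      cexp (log_pos w (index (Some i) L) - log_pos w (index None L))) < e) := h.
  by apply: filterS h' => v; rewrite !mxE.
by apply: filterS (nbhs_forall H) => v; exact: eA.
Qed.

Lemma log_domainP w : log_domain n (fun=> 1 : R) w <->
  forall i, complex.Re (w ord0 i) < 0.
Proof.
by split=> Dw i; have := Dw i; rewrite mxE ltn_ord cabs_cexp -expR0 ltr_expR.
Qed.

Lemma rconvex_log_domain : rconvex (log_domain n (fun=> 1) : set 'rV[R[i]]_n).
Proof.
move=> v w t /log_domainP hv /log_domainP hw t01; apply/log_domainP => i.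
rewrite segptE; have := hv i; have := hw i.
move: (v _ _) (w _ _) => [a b] [c d] /= c0 a0.
by rewrite mul0r subr0; nra.
Qed.

End CornerChart.

(** * Divisibility along several divisors *)

Section MultiplicityBound.
Variables (R : realType) (n : nat).
Implicit Types (z : 'rV[R[i]]_n) (g c : 'rV[R[i]]_n -> R[i]).

Local Notation D := (polydisc (fun=> 1 : R)).

Lemma bounded_cpolydisc c (r : R) : r < 1 -> holomorphic_on D c ->
  exists C : R, forall z, (forall i, cabs (z ord0 i) <= r) -> cabs (c z) <= C.
Proof.
move=> r1 hc; have cK := @compact_cpolydisc R n r.
have : compact ((fun z => cabs (c z)) @`
    [set z : 'rV[R[i]]_n | forall i, cabs (z ord0 i) <= r]).
  apply: continuous_compact => //; apply: continuous_in_subspaceT => z.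
  rewrite inE /= => zr; have Dz : D z by move=> i; exact: le_lt_trans (zr i) r1.
  have cz := differentiable_continuous (hc z Dz).
  move=> A nA; have := @cabs_continuous R (c z) A nA.
  by move/cz.
move=> /compact_bounded[M [_ HM]]; exists (M + 1) => z zr.
have := HM (M + 1); rewrite ltrDl ltr01 => /(_ isT) /(_ (cabs (c z))).
move=> /(_ (ex_intro2 _ _ z zr erefl)) /=.
by rewrite ger0_norm ?cabs_ge0.
Qed.

Definition subst_coord z (k : 'I_n) (u : R[i]) : 'rV[R[i]]_n :=
  \row_i (if i == k then u else z ord0 i).

Lemma subst_coordK z k : subst_coord z k (z ord0 k) = z.
Proof. by apply/rowP => i; rewrite mxE; case: eqP => [->|]. Qed.

Lemma differentiable_subst_coord z k u : differentiable (subst_coord z k) u.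
Proof.
have -> : subst_coord z k = (fun u => u *: (delta_mx ord0 k : 'rV[R[i]]_n)) +
    cst (\row_i (if i == k then 0 else z ord0 i)).
  apply/funext => v; apply/rowP => i; rewrite !mxE /=.
  by case: eqP => _; rewrite ?eqxx/= ?mulr1 ?mulr0 ?addr0 ?add0r.
apply: differentiableD; last exact: differentiable_cst.
have di : differentiable (id : R[i] -> R[i]) u.
  by apply/derivable1_diffP; exact: derivable_id.
exact: (@differentiableZl _ _ _ id (delta_mx ord0 k : 'rV[R[i]]_n) u di).
Qed.

(* In the variable z_k, the quotient of c by z_k^m is bounded on a circle away
   from 0, hence near 0 by the maximum principle, uniformly in the others. *)
Lemma multiplicity_bound c (m : 'I_n -> nat) (P : seq 'I_n) :
  uniq P -> holomorphic_on D c ->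
  (forall k, k \in P -> exists2 g, holomorphic_on D g &
     forall z, D z -> c z = z ord0 k ^+ m k * g z) ->
  forall r : R, 0 <= r < 1 -> exists2 C : R, 0 <= C &
    forall z, (forall i, cabs (z ord0 i) <= r) ->
      cabs (c z) <= C * \prod_(k <- P) cabs (z ord0 k) ^+ m k.
Proof.
move=> + hc; elim: P => [_ _|k P IH /= /andP[kP uP] H] r /andP[r0 r1].
  have [C HC] := bounded_cpolydisc r1 hc; exists (`|C|) => // z zr.
  by rewrite big_nil mulr1; apply: le_trans (HC z zr) (ler_norm _).
have {}IH := IH uP (fun k' k'P => H k' (mem_behead (s := k :: P) k'P)).
have [g hg cg] := H k (mem_head _ _).
(* If |z_k| < d, the circle of radius 2d about z_k lies between the moduli d and 3d, and the disc of
   radius 3d about z_k stays within modulus 4d = 1 - r, hence in the unit disc. The induction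
   hypothesis is taken at [r'], which admits both the original coordinates and the points of this
   circle. *)
pose d := (1 - r) / 4.
have d0 : 0 < d by rewrite divr_gt0// subr_gt0.
pose r' := Num.max r (3 * d).
have rr' : r <= r' by rewrite le_max lexx.
have dr' : 3 * d <= r' by rewrite le_max lexx orbT.
have r'01 : 0 <= r' < 1.
  by rewrite (le_trans r0)//= gt_max r1 /d; lra.
have [C C0 HC] := IH r' r'01.
have dm0 : 0 < d ^+ m k by rewrite exprn_gt0.
exists (C / d ^+ m k); first by rewrite divr_ge0// ltW.
move=> z zr; rewrite big_cons; set Q := \prod_(_ <- P) _.
have Q0 : 0 <= Q by apply: prodr_ge0 => i _; rewrite exprn_ge0// cabs_ge0.
have Qs u : \prod_(i <- P) cabs (subst_coord z k u ord0 i) ^+ m i = Q.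
  rewrite /Q big_seq [RHS]big_seq; apply: eq_bigr => i iP; rewrite mxE.
  by case: eqP => // ik; move: kP; rewrite -ik iP.
have gb u : d <= cabs u <= r' -> cabs (g (subst_coord z k u)) <= C / d ^+ m k * Q.
  move=> /andP[du ur]; pose zu := subst_coord z k u.
  have zur i : cabs (zu ord0 i) <= r'.
    by rewrite mxE; case: eqP => // _; exact: le_trans (zr i) rr'.
  have Dzu : D zu by move=> i; apply: le_lt_trans (zur i) _; case/andP: r'01.
  have := HC zu zur; rewrite Qs cg// cabsM cabsX.
  have -> : zu ord0 k = u by rewrite mxE eqxx.
  move=> h; rewrite mulrAC ler_pdivlMr// mulrC; apply: le_trans h.
  by rewrite ler_wpM2r ?cabs_ge0// lerXn2r// nnegrE ?cabs_ge0// ltW.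
have Dz : D z by move=> i; exact: le_lt_trans (zr i) r1.
have gz : cabs (g z) <= C / d ^+ m k * Q.
  have [dz|zd] := leP d (cabs (z ord0 k)).
    rewrite -{1}(subst_coordK z k); apply: gb; rewrite dz/=.
    exact: le_trans (zr k) rr'.
  pose G u := g (subst_coord z k u).
  have -> : g z = G (z ord0 k) by rewrite /G subst_coordK.
  apply: (@maximum_principle R G (z ord0 k) (2 * d)); first by rewrite mulr_gt0.
    exists (3 * d); first by rewrite ltr_pM2r// ltr_nat.
    move=> h hd; have hb : cabs (z ord0 k + h) < 1.
      by apply: le_lt_trans (ler_cabsD _ _) _; move: zd hd; rewrite /d; lra.
    apply: (@differentiable_comp _ _ _ _ (subst_coord z k) g).
      exact: differentiable_subst_coord.
    apply: hg => i; rewrite mxE; case: eqP => // _; exact: Dz.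
  move=> h hd; apply: gb; apply/andP; split.
    have := ler_cabsB h (- z ord0 k); rewrite opprK cabsN hd (addrC h) addrC.
    by move: zd; move: (cabs _) (cabs _) => a b; lra.
  apply: le_trans dr'; apply: le_trans (ler_cabsD _ _) _; rewrite hd.
  by move: zd; move: (cabs _) => a; lra.
rewrite cg// cabsM cabsX mulrCA ler_wpM2l//.
by rewrite exprn_ge0// cabs_ge0.
Qed.

End MultiplicityBound.

(** * Summability *)

Section GeometricBounds.
Variable R : realType.
Implicit Types (x y eta theta : R).

Lemma geometric_sum_le y k : 0 <= y < 1 -> \sum_(i < k) y ^+ i <= (1 - y)^-1.
Proof.
move=> /andP[y0 y1]; have y1' : 0 < 1 - y by rewrite subr_gt0.
rewrite -[leRHS]mul1r ler_pdivlMr//.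
have -> : (\sum_(i < k) y ^+ i) * (1 - y) = 1 - y ^+ k.
  elim: k => [|k IH]; first by rewrite big_ord0 mul0r expr0 subrr.
  by rewrite big_ord_recr/= mulrDl IH exprSr; ring.
by rewrite lerBlDr lerDl exprn_ge0.
Qed.

Lemma bernoulli_le x k : 0 <= x <= 1 -> 1 - x *+ k <= (1 - x) ^+ k.
Proof.
move=> /andP[x0 x1]; elim: k => [|k IH]; first by rewrite mulr0n subr0 expr0.
rewrite exprS mulrS; have xk : 0 <= x *+ k by rewrite mulrn_wge0.
have x1' : 0 <= 1 - x by rewrite subr_ge0.
have := ler_wpM2l x1' IH; move: (x *+ k) xk ((1 - x) ^+ k) => a a0 b h.
by apply: le_trans h; nra.
Qed.

(** By Bernoulli's inequality, y = 1 - (1 - theta) / (N + 1) satisfies theta <= y^(N+1). Of the N +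
    1 factors y^k, N absorb the powers of k + 1, as (k + 1) y^k is at most the sum of y^i for i <=
    k, hence at most 1 / (1 - y); the last factor is kept. *)
Lemma poly_geometric_le theta N : 0 <= theta < 1 -> exists eta C : R,
  [/\ 0 <= eta < 1, 0 <= C &
      forall k : nat, (k.+1%:R) ^+ N * theta ^+ k <= C * eta ^+ k].
Proof.
move=> /andP[t0 t1]; pose x := (1 - theta) / N.+1%:R; pose y := 1 - x.
have x0 : 0 < x by rewrite divr_gt0// subr_gt0.
have x1 : x <= 1.
  rewrite ler_pdivrMr// mul1r; apply: (@le_trans _ _ 1); first lra.
  by rewrite ler1n.
have y01 : 0 <= y < 1 by rewrite /y; lra.
have ty : theta <= y ^+ N.+1.
  apply: le_trans (bernoulli_le N.+1 _); last by rewrite (ltW x0).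
  rewrite -[x *+ _]mulr_natr /x divfK ?pnatr_eq0//; lra.
case/andP: (y01) => y0 y1.
exists y, ((1 - y)^-1 ^+ N); split=> //.
  by rewrite exprn_ge0// invr_ge0 subr_ge0 ltW.
move=> k; have ky : k.+1%:R * y ^+ k <= (1 - y)^-1.
  apply: le_trans (geometric_sum_le k.+1 y01).
  rewrite mulrC mulr_natr -[k.+1 in leLHS]card_ord -sumr_const.
  apply: ler_sum => i _; apply: ler_wiXn2l => //; first exact: ltW.
  by rewrite -ltnS.
apply: (@le_trans _ _ (k.+1%:R ^+ N * (y ^+ N.+1) ^+ k)).
  by rewrite ler_wpM2l ?exprn_ge0// lerXn2r// nnegrE exprn_ge0.
rewrite -exprM mulSn mulnC exprD exprM mulrA mulrAC.
rewrite -exprMn ler_wpM2r ?exprn_ge0// lerXn2r// nnegrE.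
  by rewrite mulr_ge0// exprn_ge0.
by rewrite invr_ge0 subr_ge0 ltW.
Qed.

Lemma summable_geometric n eta C : 0 <= eta < 1 -> 0 <= C ->
  summable [set: 'rV[int]_n]
    (fun m : 'rV[int]_n => (C * \prod_(i < n) eta ^+ `|m ord0 i|%N)%:E).
Proof.
move=> eta01 C0; have /andP[eta0 _] := eta01.
pose F (m : 'rV[int]_n) : R := C * \prod_(i < n) eta ^+ `|m ord0 i|%N.
have F0 m : 0 <= F m by rewrite mulr_ge0// prodr_ge0// => i _; rewrite exprn_ge0.
pose B := C * (2 * (1 - eta)^-1) ^+ n.
suff : (\esum_(m in [set: 'rV[int]_n]) `|(F m)%:E| <= B%:E)%E.
  by move=> /le_lt_trans; apply; rewrite ltry.
apply: ge_ereal_sup => _ [A [finA _] <-].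
rewrite fsbig_finite//=; under eq_bigr do rewrite ger0_norm//.
rewrite sumEFin lee_fin; set s := finmap.enum_fset _.
have us : uniq s by exact: finmap.fset_uniq.
pose K := \max_(m <- s) \max_(i < n) `|m ord0 i|%N.
have mK m i : m \in s -> (`|m ord0 i| < K.+1)%N.
  move=> ms; rewrite ltnS; apply: leq_trans (leq_bigmax_seq _ ms _) => //.
  exact: (leq_bigmax (F := fun i => `|m ord0 i|%N)).
(* Signs and absolute values embed the finite set into a full product of finite sets, over which the
   sum factors; each of the n factors is at most 2 / (1 - eta). *)
pose enc (m : 'rV[int]_n) : {ffun 'I_n -> bool * 'I_K.+1} :=
  [ffun i => (0 <= m ord0 i, inord `|m ord0 i|%N)].
have enc_inj : {in s &, injective enc}.
  move=> m m' ms m's /ffunP mm'; apply/rowP => i.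
  have := mm' i; rewrite !ffunE => -[sg /(congr1 (@nat_of_ord _))].
  rewrite !inordK ?mK// => ab; move: sg ab.
  by case: (m ord0 i) => a; case: (m' ord0 i) => b //= _; lia.
pose G (j : {ffun 'I_n -> bool * 'I_K.+1}) : R := C * \prod_(i < n) eta ^+ (j i).2.
have G0 j : 0 <= G j by rewrite mulr_ge0// prodr_ge0// => i _; rewrite exprn_ge0.
have -> : \sum_(m <- s) F m = \sum_(j <- map enc s) G j.
  rewrite big_map big_seq [RHS]big_seq; apply: eq_bigr => m ms.
  by congr (_ * _); apply: eq_bigr => i _; rewrite ffunE /= inordK// mK.
rewrite big_uniq/=; last by rewrite map_inj_in_uniq.
apply: (@le_trans _ _ (\sum_j G j)).
  by rewrite [leRHS](bigID [in map enc s])/= lerDl sumr_ge0.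
rewrite /G -big_distrr/= ler_wpM2l//.
rewrite -(bigA_distr_bigA (fun (i : 'I_n) (p : bool * 'I_K.+1) => eta ^+ p.2)).
rewrite prodr_const card_ord lerXn2r ?nnegrE//.
- by apply: sumr_ge0 => p _; rewrite exprn_ge0.
- by rewrite mulr_ge0// invr_ge0 subr_ge0; case/andP: eta01 => _ /ltW.
rewrite -(pair_big xpredT xpredT (fun (b : bool) (k : 'I_K.+1) => eta ^+ k))/=.
rewrite big_bool/= mulrDl mul1r.
by rewrite lerD// geometric_sum_le.
Qed.

Lemma annulus_gap n (tau : R[i]) (K : set 'rV[R[i]]_n) : compact K -> K `<=` annuli n tau ->
  exists2 theta : R, 0 <= theta < 1 & forall u i, K u ->
    cabs (u ord0 i) * cabs (qpow tau 1) <= theta /\ (cabs (u ord0 i))^-1 <= theta.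
Proof.
move=> cK KA; have q0 : 0 < cabs (qpow tau 1) by rewrite cabs_gt0 cexp_neq0.
have H (i : 'I_n) : exists theta : R, 0 <= theta < 1 /\ forall u, K u ->
    cabs (u ord0 i) * cabs (qpow tau 1) <= theta /\ (cabs (u ord0 i))^-1 <= theta.
  have [->|/set0P K0] := eqVneq K set0.
    by exists 0; rewrite lexx ltr01; split=> // u [].
  have cc : {within K, continuous (fun u : 'rV[R[i]]_n => cabs (u ord0 i))}.
    apply: continuous_subspaceT => u A nA.
    exact: (@coord_continuous _ _ _ ord0 i u _ (@cabs_continuous R _ A nA)).
  have [u1 /set_mem Ku1 h1] := compact_EVT_max K0 cK cc.
  have [u2 /set_mem Ku2 h2] := compact_EVT_min K0 cK cc.
  have /andP[a1 a2] := KA _ Ku1 i; have /andP[b1 b2] := KA _ Ku2 i.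
  have a0 : 0 < cabs (u1 ord0 i) by exact: lt_trans ltr01 a1.
  have b0 : 0 < cabs (u2 ord0 i) by exact: lt_trans ltr01 b1.
  exists (Num.max (cabs (u1 ord0 i) * cabs (qpow tau 1)) (cabs (u2 ord0 i))^-1).
  split.
    rewrite le_max invr_ge0 (ltW b0) orbT/= gt_max invf_lt1// b1 andbT.
    by rewrite -ltr_pdivlMr// mul1r.
  move=> u Ku; rewrite !le_max; split; apply/orP; [left|right].
    by rewrite ler_pM2r//; apply: h1; exact: mem_set.
  have c0 : 0 < cabs (u ord0 i) by have /andP[c1 _] := KA _ Ku i; exact: lt_trans c1.
  by rewrite lef_pV2//; apply: h2; exact: mem_set.
have [th thP] := choice H.
exists (\big[Num.max/0]_i th i).
  apply/andP; split; first by rewrite bigmax_ge_id.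
  by apply: bigmax_lt => // i _; case/andP: (thP i).1.
move=> u i Ku; have [h1 h2] := (thP i).2 u Ku.
by split; [apply: le_trans h1 _|apply: le_trans h2 _]; exact: le_bigmax.
Qed.

End GeometricBounds.

(** * Estimate of the continued branch *)

Section Estimate.
Variables (R : realType) (n : nat) (f : multivalued (M0n R n)).
Variables (tau : R[i]) (t : 'rV[R[i]]_n) (y0 : mv_space f).
Variable sigma : 'rV[R]_n -> mv_space f.
Hypothesis f_unipotent : unipotent f.
Hypothesis t_in_calS : in_calS tau t.
Hypothesis sigma_continuation : continuation tau t y0 sigma.
Hypothesis f_vanishes : forall I : {set 'I_n}, I != finset.set0 ->
  vanishes_along sigma (divisor_type0 R I) #|I|.
Variable ell_t : 'I_n -> R[i].
Hypothesis ell_tP : forall i, cexp (ell_t i) = t ord0 i.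
Implicit Types (s : 'rV[R]_n) (o : option 'I_n) (m : 'rV[int]_n).

Local Notation Om := (log_domain n (fun=> 1 : R)).
Local Notation Lam := (2 * pi * complex.Im tau : R).
Local Notation order := (n.+1.-tuple (option 'I_n)).

(** Logarithms of q^(s_i) t_i, affine in s once logarithms of the t_i are fixed; [None] is the point
    1. *)
Definition log_item s o : R[i] :=
  if o is Some i then
    (0 +i* (2 * pi))%C * tau * (s ord0 i)%:C%C + ell_t i
  else 0.

Let Lam_gt0 : 0 < Lam.
Proof. by case: t_in_calS => h _ _ _ _; rewrite !mulr_gt0// pi_gt0. Qed.

Let Re_log_item s i :
  complex.Re (log_item s (Some i)) = complex.Re (ell_t i) - Lam * s ord0 i.
Proof.
by rewrite /=; case: tau => a b; case: (ell_t i) => c d /=; ring.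
Qed.

Let cabs_q : cabs (qpow tau 1) = expR (- Lam).
Proof. by rewrite cabs_cexp; case: tau => a b /=; congr expR; ring. Qed.

Let Re_ell i : - Lam < complex.Re (ell_t i) < 0.
Proof.
case: t_in_calS => _ /(_ i) + _ _ _.
by rewrite cabs_q -ell_tP cabs_cexp ltr_expR -[1]expR0 ltr_expR.
Qed.

Let Re_ell_lt (i j : 'I_n) : (i < j)%N -> complex.Re (ell_t i) < complex.Re (ell_t j).
Proof.
move=> ij; case: t_in_calS => _ _ /(_ i j ij) + _ _.
by rewrite -!ell_tP !cabs_cexp ltr_expR.
Qed.

Lemma item_pt_qtranslate s o : item_pt (qtranslate tau t s) o = cexp (log_item s o).
Proof. by case: o => [i|] /=; rewrite ?cexp0// mxE cexpD ell_tP. Qed.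

Section Order.
Variable L : order.
Hypothesis uL : uniq L.

(** Logarithmic chart coordinates of the point with parameters s. They are affine in s, so segments
    of parameters become segments of the convex domain [Om]. *)
Definition log_ratio s : 'rV[R[i]]_n :=
  \row_j (log_item s (item L j) - log_item s (item L j.+1)).

Lemma log_pos_ratio s x : (x <= n)%N ->
  log_pos (log_ratio s) x = log_item s (item L x) - log_item s (item L 0).
Proof.
elim: x => [_|x IH xn]; first by rewrite /log_pos big_pred0 ?subrr ?oppr0.
have := log_posS (log_ratio s) (Ordinal xn) => /=.
rewrite IH 1?ltnW// mxE /= => /(congr1 (fun u => u - (log_item s (item L x) -
  log_item s (item L x.+1)))).
by rewrite [in RHS]addrC addKr => <-; ring.
Qed.

Lemma log_point_ratio s : log_point L (log_ratio s) = qtranslate tau t s.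
Proof.
have io k : (index k L <= n)%N by rewrite -ltnS; exact: index_order.
apply/rowP => i; rewrite [LHS]mxE.
have := item_pt_qtranslate s (Some i) => /= ->; congr cexp.
by rewrite !log_pos_ratio// !item_index//=; ring.
Qed.

Lemma Re_log_ratio s (j : 'I_n) : complex.Re (log_ratio s ord0 j) =
  complex.Re (log_item s (item L j)) - complex.Re (log_item s (item L j.+1)).
Proof. by rewrite mxE; case: (log_item _ _) => a b; case: (log_item _ _). Qed.

Lemma log_domain_ratio s : Om (log_ratio s) <->
  forall j, complex.Re (log_ratio s ord0 j) < 0.
Proof.
exact: log_domainP.
Qed.

Lemma log_ratio_segpt s s' (r : R) :
  log_ratio (s + r *: (s' - s)) = segpt (log_ratio s) (log_ratio s') r.
Proof.
have E o : log_item (s + r *: (s' - s)) o =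
    log_item s o + r%:C%C * (log_item s' o - log_item s o).
  case: o => [i|] /=; last by rewrite subrr mulr0 addr0.
  rewrite !mxE rmorphD rmorphM rmorphB/=.
  by move: (s ord0 i)%:C%C (s' ord0 i)%:C%C (r%:C)%C => a b c; ring.
apply/rowP => j; rewrite segptE ![log_ratio _ _ _]mxE !E.
by move: (log_item _ _) (log_item _ _) (log_item _ _) (log_item _ _) (r%:C)%C => *; ring.
Qed.

(* A point at which all coordinates have modulus exp (- B). *)
Definition deep_point (B : R) : 'rV[R]_n :=
  \row_i ((complex.Re (ell_t i) -
    ((index (Some i) L)%:R - (index None L)%:R) * B) / Lam).

Lemma Re_log_ratio_deep B j : complex.Re (log_ratio (deep_point B) ord0 j) = - B.
Proof.
have E o : complex.Re (log_item (deep_point B) o) =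
    ((index o L)%:R - (index None L)%:R) * B.
  case: o => [i|]; last by rewrite /= subrr mul0r.
  rewrite Re_log_item mxE [Lam * _]mulrC divfK ?gt_eqF//; ring.
have jn : (j < n)%N by [].
have e1 : index (item L j) L = j by rewrite index_item// ltnW.
have e2 : index (item L j.+1) L = j.+1 by rewrite index_item.
rewrite Re_log_ratio !E e1 e2 -natr1; ring.
Qed.

(** The lift lives on a domain of real dimension 2n, the continuation only over a slice of dimension
    n. They are made equal at one deep point, and uniqueness of lifts along the segment from there
    extends equality to every s of this order. Deeper points then approach the centre of the chart,
    as [chosen_branch] demands. *)
Lemma lift_along_order : exists ell : 'rV[R[i]]_n -> mv_space f,
  [/\ branch_at n (fun=> 1) (corner_map L) ell,
      chosen_branch sigma n (fun=> 1) ell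
    & forall s, Om (log_ratio s) -> ell (log_ratio s) = sigma s].
Proof.
case: sigma_continuation => cs _ ps.
have deepD B : 0 < B -> Om (log_ratio (deep_point B)).
  by move=> B0; apply/log_domain_ratio => j; rewrite Re_log_ratio_deep oppr_lt0.
have [|||ell [cell pell ell0]] := @lift_exists _ _ _ _ _ (mv_covering f) _ Om
    (log_point L) (log_ratio (deep_point 1)) (sigma (deep_point 1))
    (@rconvex_log_domain R n) (@log_point_continuous R n L).
- by move=> w Ow; exact: log_point_M0n.
- exact: deepD.
- by rewrite ps log_point_ratio.
have agree s : Om (log_ratio s) -> ell (log_ratio s) = sigma s.
  move=> Os; pose s0 := deep_point 1; pose path r := s0 + r *: (s - s0).
  have seg (r : R) : `[0, 1]%classic r -> Om (segpt (log_ratio s0) (log_ratio s) r).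
    by rewrite /= in_itv /= => r01; apply: rconvex_log_domain => //; exact: deepD.
  have cpath : continuous path.
    move=> r; apply: cvgD; first exact: cvg_cst.
    by apply: cvgZr_tmp; exact: cvg_id.
  have c1 : cont_on `[0 : R, 1] (ell \o segpt (log_ratio s0) (log_ratio s)).
    apply: cont_on_comp cell => //.
    by apply: continuous_cont_on; exact: segpt_continuous.
  have c2 : cont_on `[0 : R, 1] (sigma \o path).
    by apply: continuous_cont_on => r; apply: continuous_comp; [exact: cpath|exact: cs].
  have := @lift_unique _ _ _ _ _ (mv_covering f) R `[0 : R, 1]
    _ _ 0 (@segment_connected _ 0 1) c1 c2.
  rewrite /= segpt0 /path scale0r addr0 => H.
  have := H _ _ ell0 1; rewrite segpt1 scale1r (addrC s0) subrK; apply.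
  - move=> r /seg Or; rewrite pell// -log_ratio_segpt log_point_ratio ps.
    split=> //; rewrite -log_point_ratio; apply: log_point_M0n => //.
    by rewrite log_ratio_segpt.
  - by rewrite /= in_itv /= lexx ler01.
  - by rewrite /= in_itv /= lexx ler01.
exists ell; split=> //.
- split; first exact/cont_onP.
  by move=> w Ow; rewrite pell// cross_ratio_log_point.
(* This makes exp (- B) at most e / exp 1, hence smaller than e. *)
- move=> e e0; pose B := Num.max 1 (1 - ln e).
  have B0 : 0 < B by rewrite lt_max ltr01.
  exists (deep_point B), (log_ratio (deep_point B)); split.
  + exact: deepD.
  + move=> j; rewrite mxE ltn_ord cabs_cexp Re_log_ratio_deep.
    rewrite -[ltRHS](lnK e0) ltr_expR ltrNl lt_max; apply/orP; right.
    by rewrite ltrBrDr; move: (ln e) => x; lra.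
  + by apply: agree; exact: deepD.
Qed.

End Order.

(** The modulus of q^k t_i is below 1 exactly for k >= 0, since |q| < |t_i| < 1; negative k are
    given the factor 1. *)
Definition decay (k : int) : R := if k is Posz k' then cabs (qpow tau 1) ^+ k' else 1.

Let decay_ge0 k : 0 <= decay k.
Proof. by case: k => k //=; rewrite exprn_ge0// cabs_ge0. Qed.

Local Notation real_row m := (map_mx (fun z : int => z%:~R : R) m).
(** A product over the coordinates, so that its powers split in the final multiple series. *)
Local Notation poly_growth m := (\prod_(i < n) (`|m ord0 i|%N.+1)%:R : R).

Let decay_item m o : R := if o is Some i then decay (m ord0 i) else 1.

Let Re_log_item_int m i : complex.Re (log_item (real_row m) (Some i)) =
  complex.Re (ell_t i) - Lam * (m ord0 i)%:~R.
Proof. by rewrite Re_log_item mxE. Qed.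

Let decay_item_ge m o : complex.Re (log_item (real_row m) o) < 0 ->
  expR (complex.Re (log_item (real_row m) o)) <= decay_item m o.
Proof.
case: o => [i|]; last by rewrite /= ltxx.
rewrite Re_log_item_int /decay_item; have /andP[l1 l2] := Re_ell i.
have L0 := Lam_gt0; case: (m ord0 i) => k; rewrite /decay => rho0.
  rewrite cabs_q -expRM_natl ler_expR -[(Posz k)%:~R]/(k%:R : R).
  move: Lam (k%:R : R) (complex.Re (ell_t i)) l2 => u v w l2; lra.
exfalso; move: rho0; rewrite NegzE mulrNz -[(Posz k.+1)%:~R]/(k.+1%:R : R) -(natr1 k).
have : 0 <= k%:R :> R by [].
move: Lam (k%:R : R) (complex.Re (ell_t i)) L0 l1 => u v w u0 wl v0; nra.
Qed.

Let decay_item_eq1 m o : 0 <= complex.Re (log_item (real_row m) o) ->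
  decay_item m o = 1.
Proof.
case: o => [i|//]; rewrite Re_log_item_int /decay_item; have /andP[l1 l2] := Re_ell i.
have L0 := Lam_gt0; case: (m ord0 i) => k //= rho0.
exfalso; move: rho0; rewrite -[(Posz k)%:~R]/(k%:R : R).
have : 0 <= k%:R :> R by [].
move: Lam (k%:R : R) (complex.Re (ell_t i)) L0 l2 => u v w u0 wl v0; nra.
Qed.

Let poly_growth_ge m i : (`|m ord0 i|%N.+1)%:R <= poly_growth m.
Proof.
rewrite (bigD1 i)//= ler_peMr//; apply: (big_ind (fun x : R => 1 <= x)) => //.
- by move=> x y x1 y1; rewrite -[1]mulr1 ler_pM.
- by move=> j _; rewrite ler1n.
Qed.

Let poly_growth_ge1 m : 1 <= poly_growth m.
Proof.
apply: (big_ind (fun x : R => 1 <= x)) => //.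
- by move=> x y x1 y1; rewrite -[1]mulr1 ler_pM.
- by move=> j _; rewrite ler1n.
Qed.

Let log_item_bound : exists2 K : R, 0 <= K & forall m o,
  cabs (log_item (real_row m) o) <= K * poly_growth m.
Proof.
pose K1 := cabs ((0 +i* (2 * pi))%C * tau); pose K2 := \sum_i cabs (ell_t i).
have K10 : 0 <= K1 by exact: cabs_ge0.
have K20 : 0 <= K2 by apply: sumr_ge0 => i _; exact: cabs_ge0.
exists (K1 + K2) => [|m o]; first exact: addr_ge0.
case: o => [i|] /=; last first.
  by rewrite cabs0 mulr_ge0 ?addr_ge0// (le_trans ler01)// poly_growth_ge1.
apply: (@le_trans _ _ ((K1 + K2) * (`|m ord0 i|%N.+1)%:R)); last first.
  by rewrite ler_wpM2l ?addr_ge0// poly_growth_ge.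
apply: le_trans (ler_cabsD _ _) _; rewrite cabsM -/K1 cabs_real mxE mulrDl lerD//.
  rewrite ler_wpM2l// -intr_norm -abszE -natr1 lerDl//.
apply: (@le_trans _ _ K2); last by rewrite ler_peMr// ler1n.
by rewrite /K2 (bigD1 i)//= lerDl sumr_ge0// => j _; exact: cabs_ge0.
Qed.

Section OrderEstimate.
Variable L : order.
Hypothesis uL : uniq L.

Let a := index None L.

Lemma prod_order (h : option 'I_n -> R) : h None = 1 ->
  \prod_(k < n.+1) h (item L k) = \prod_(i < n) h (Some i).
Proof.
move=> h1; transitivity (\prod_(o <- L) h o).
  by rewrite (big_nth None) big_mkord size_tuple.
have P : perm_eq L (None :: map Some (enum 'I_n)).
  apply: uniq_perm => // [|o].
    rewrite /= (map_inj_uniq (@Some_inj _)) enum_uniq andbT.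
    by apply/negP => /mapP[].
  rewrite mem_order// inE; case: o => [i|]; rewrite ?eqxx//=.
  by rewrite (mem_map (@Some_inj _)) mem_enum.
by rewrite (perm_big _ P)/= big_cons h1 mul1r big_map big_enum.
Qed.

(* Abel summation turns the product of the |z_k|^(k+1) into the product of the
   moduli of the points preceding 1. *)
Lemma monomial_decay m : (forall j, complex.Re (log_ratio L (real_row m) ord0 j) < 0) ->
  \prod_(k <- [seq j : 'I_n <- enum 'I_n | (j < a)%N])
    cabs (from_log n (log_ratio L (real_row m)) ord0 k) ^+ k.+1
  <= \prod_(i < n) decay (m ord0 i).
Proof.
move=> neg; pose rho x := complex.Re (log_item (real_row m) (item L x)).
have an : (a <= n)%N by rewrite -ltnS; exact: index_order.
have rhoa : rho a = 0 by rewrite /rho item_index.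
have rhoS (j : 'I_n) : rho j < rho j.+1.
  by have := neg j; rewrite Re_log_ratio subr_lt0.
have rho_le x y : (x <= y <= n)%N -> rho x <= rho y.
  move=> /andP[]; elim: y => [|y IH]; first by rewrite leqn0 => /eqP ->.
  rewrite leq_eqVlt => /predU1P[->//|xy] yn.
  by apply: le_trans (IH xy (ltnW yn)) _; exact: ltW (rhoS (Ordinal yn)).
have rho_lt x : (x < a)%N -> rho x < 0.
  move=> xa; have xn : (x < n)%N by exact: leq_trans an.
  apply: lt_le_trans (rhoS (Ordinal xn)) _; rewrite -rhoa; apply: rho_le.
  by rewrite xa.
rewrite big_filter big_enum_cond/=.
pose G (k : nat) := k.+1%:R * (rho k - rho k.+1).
have -> : \prod_(j < n | (j < a)%N)
    cabs (from_log n (log_ratio L (real_row m)) ord0 j) ^+ j.+1 =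
    \prod_(j < n | (j < a)%N) expR (G j).
  apply: eq_bigr => j _; rewrite mxE ltn_ord cabs_cexp Re_log_ratio.
  by rewrite -expRM_natl.
rewrite -(big_morph expR (@expRD R) (@expR0 R)).
rewrite -(big_ord_widen n G an).
have -> : \sum_(i < a) G i = \sum_(i < a) rho i.
  (* Summation by parts; the boundary term disappears at b = a, where the point is 1 and its
     logarithm is 0. *)
  have H b : \sum_(i < b) G i = \sum_(i < b) rho i - b%:R * rho b.
    elim: b => [|b IH]; first by rewrite !big_ord0 mul0r subr0.
    by rewrite !big_ord_recr/= IH /G -natr1; ring.
  by rewrite H rhoa mulr0 subr0.
rewrite (big_morph expR (@expRD R) (@expR0 R)).
rewrite (_ : \prod_(i < n) decay (m ord0 i) =
  \prod_(i < a) decay_item m (item L i)).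
  apply: ler_prod => i _; rewrite expR_ge0/=; apply: decay_item_ge.
  exact: rho_lt.
rewrite -(prod_order (h := decay_item m))//.
rewrite (bigID (fun k : 'I_n.+1 => (k < a)%N))/= [X in _ * X]big1 ?mulr1.
  by rewrite -(big_ord_widen n.+1 (fun k => decay_item m (item L k)))// ltnW.
move=> k; rewrite -leqNgt => ak; apply: decay_item_eq1.
by have := rho_le a k; rewrite rhoa ak -ltnS ltn_ord; exact.
Qed.

Lemma order_estimate (d : R) : 0 < d -> exists (C : R) (N : nat), 0 <= C /\
  forall m, (forall j, complex.Re (log_ratio L (real_row m) ord0 j) <= - d) ->
    cabs (mv_val (sigma (real_row m))) <=
      C * poly_growth m ^+ N * \prod_(i < n) decay (m ord0 i).
Proof.
move=> d0; have [ell [br ch ag]] := lift_along_order uL.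
have ck := @corner_chart R n L uL.
have [N [c [hc ex]]] := f_unipotent ck br.
have [K K0 HK] := log_item_bound.
pose P := [seq j : 'I_n <- enum 'I_n | (j < a)%N].
have r01 : 0 <= expR (- d) < 1 by rewrite expR_ge0 -expR0 ltr_expR oppr_lt0.
have Jn (J : {ffun 'I_n -> 'I_N.+1}) : log_exponent n J.
  by apply/forallP => i; rewrite leqNgt ltn_ord.
have HC (J : {ffun 'I_n -> 'I_N.+1}) : exists C : R, 0 <= C /\
    forall z : 'rV[R[i]]_n, (forall i, cabs (z ord0 i) <= expR (- d)) ->
      cabs (c J z) <= C * \prod_(k <- P) cabs (z ord0 k) ^+ k.+1.
  have [||C C0 HC] := @multiplicity_bound R n (c J) (fun k => k.+1) P _ (hc J (Jn J)) _ _ r01.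
  - by rewrite filter_uniq// enum_uniq.
  - move=> k; rewrite mem_filter => /andP[ka _].
    have I0 : initial_items L k != finset.set0.
      by rewrite -card_gt0 card_initial_items.
    have divE z := @divisor_type0_corner R n L uL k z ka.
    have := f_vanishes I0 ck br ch divE (conj hc ex) (Jn J).
    by rewrite card_initial_items.
  - by exists C.
have [CJ CJP] := choice HC.
(* A logarithmic coordinate is a difference of two logarithms, each at most K times [poly_growth m],
   whence 2 K; the added 1 gives [T >= 1], so every exponent can be raised to N. The n coordinates
   together give the power N n. *)
pose A := 2 * K + 1.
have A0 : 0 <= A by rewrite /A; lra.
exists ((\sum_J CJ J) * A ^+ (N * n)), (N * n)%N; split.
  by rewrite mulr_ge0 ?exprn_ge0// sumr_ge0// => J _; exact: (CJP J).1.
move=> m md; set s := real_row m; set w := log_ratio L s.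
have wneg j : complex.Re (w ord0 j) < 0.
  by apply: le_lt_trans (md j) _; rewrite oppr_lt0.
have Ow : Om w by apply/log_domainP.
rewrite -(ag s Ow) ex//.
pose T := A * poly_growth m.
have pg1 := poly_growth_ge1 m.
have T1 : 1 <= T.
  by rewrite /T /A; move: pg1 K0; move: (poly_growth m) => p; nra.
have wT j : cabs (w ord0 j) <= T.
  rewrite mxE; apply: le_trans (ler_cabsD _ _) _; rewrite cabsN.
  apply: le_trans (lerD (HK m _) (HK m _)) _.
  by rewrite /T /A; move: pg1; move: (poly_growth m) => p; nra.
apply: le_trans (ler_cabs_sum _ _ _) _.
set Dk := \prod_(i < n) decay _.
have Dk0 : 0 <= Dk by apply: prodr_ge0 => i _; exact: decay_ge0.
apply: (@le_trans _ _ (\sum_(J : {ffun 'I_n -> 'I_N.+1}) (T ^+ (N * n) * (CJ J * Dk)))).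
  rewrite (eq_bigl predT) => [|J]; last by rewrite Jn.
  apply: ler_sum => J _; rewrite cabsM ler_pM ?cabs_ge0//.
    rewrite cabs_prod exprM -[X in T ^+ N ^+ X]card_ord -prodr_const.
    apply: ler_prod => i _; rewrite cabs_ge0/= cabsX.
    apply: (@le_trans _ _ (T ^+ J i)).
      by rewrite lerXn2r// nnegrE ?cabs_ge0// (le_trans ler01).
    by rewrite ler_weXn2l// -ltnS.
  apply: le_trans ((CJP J).2 _ _) _.
    by move=> i; rewrite mxE ltn_ord cabs_cexp ler_expR; exact: md.
  by rewrite ler_wpM2l ?(CJP J).1//; exact: monomial_decay.
rewrite -big_distrr/= -big_distrl/= /T exprMn.
by rewrite le_eqVlt; apply/orP; left; apply/eqP; ring.
Qed.

End OrderEstimate.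

(** The representative in (- Lam, 0] of the real part of the logarithm modulo Lam; translating by an
    integer m_i moves it by a multiple of Lam. *)
Let base o : R := if o is Some i then complex.Re (ell_t i) else 0.

Let base_bound o : - Lam < base o <= 0.
Proof.
case: o => [i|] /=; last by rewrite oppr_lt0 Lam_gt0 lexx.
by have /andP[-> /ltW ->] := Re_ell i.
Qed.

Let base_inj : injective base.
Proof.
move=> [i|] [j|] //= h.
- have [ij|ji|/val_inj -> //] := ltngtP i j.
    by have := Re_ell_lt ij; rewrite h ltxx.
  by have := Re_ell_lt ji; rewrite h ltxx.
- by have := Re_ell i; rewrite h ltxx andbF.
- by have := Re_ell j; rewrite -h ltxx andbF.
Qed.

(* The real parts of the logarithms lie in pairwise distinct classes mod Lam. *)
Lemma log_item_gap : exists2 d : R, 0 < d & forall m o o', o != o' ->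
  d <= `|complex.Re (log_item (real_row m) o) - complex.Re (log_item (real_row m) o')|.
Proof.
(* The distance from a difference of representatives to the lattice of multiples of Lam: the
   difference is smaller than Lam in absolute value, so the nearest multiple is 0 or one of its two
   neighbours. *)
pose g (p : option 'I_n * option 'I_n) : R :=
  Num.min `|base p.1 - base p.2| (Lam - `|base p.1 - base p.2|).
exists (\big[Num.min/1]_(p | p.1 != p.2) g p).
  apply: lt_bigmin => // -[u v] /= uv; rewrite lt_min normr_gt0 subr_eq0.
  rewrite (inj_eq base_inj) uv subr_gt0 /=.
  have := base_bound u; have := base_bound v; rewrite ltr_norml.
  by move: (base u) (base v) Lam => x y z; lra.
move=> m u v uv; apply: (@le_trans _ _ (g (u, v))); first exact: bigmin_le_cond.
pose mi o : int := if o is Some i then m ord0 i else 0.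
have E o : complex.Re (log_item (real_row m) o) = base o - Lam * (mi o)%:~R.
  by case: o => [i|]; rewrite ?Re_log_item_int// /= mulr0 subr0.
rewrite !E (_ : _ - _ = (base u - base v) - Lam * (mi u - mi v)%:~R); last first.
  by rewrite rmorphB/=; ring.
rewrite ge_min; have [->|k0] := eqVneq (mi u - mi v) 0.
  by rewrite mulr0 subr0 lexx.
apply/orP; right; rewrite (distrC (_ - _)); apply: le_trans (lerB_dist _ _) => /=.
rewrite lerD2r normrM gtr0_norm// ler_peMr ?(ltW Lam_gt0)//.
by rewrite -intr_norm -abszE ler1n absz_gt0.
Qed.

(** The order sorts the points by modulus and is chosen before d: sorting makes consecutive
    differences nonpositive, and any lower bound on their absolute values then sharpens this. *)
Lemma sorted_order m : exists2 L : order, uniq L &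
  forall d : R, (forall o o', o != o' -> d <=
      `|complex.Re (log_item (real_row m) o) - complex.Re (log_item (real_row m) o')|) ->
    forall j, complex.Re (log_ratio L (real_row m) ord0 j) <= - d.
Proof.
pose rho o := complex.Re (log_item (real_row m) o).
pose r : rel (option 'I_n) := fun o o' => rho o <= rho o'.
have sz : size (sort r (enum {: option 'I_n})) == n.+1.
  by rewrite size_sort -cardE card_option card_ord.
have uL : uniq (Tuple sz) by rewrite sort_uniq enum_uniq.
exists (Tuple sz) => // d Hd j.
have rt : total r by move=> x y; exact: le_total.
have jn : (j.+1 < n.+1)%N by rewrite ltnS.
have := sortedP None (sort_sorted rt (enum {: option 'I_n})).
rewrite (eqP sz) => /(_ j jn) sj.
rewrite Re_log_ratio.
have ne : item (Tuple sz) j != item (Tuple sz) j.+1.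
  rewrite /item /= (nth_uniq None _ _ uL) ?(eqP sz)//; first by rewrite ltn_eqF.
  by rewrite ltnW.
have := Hd _ _ ne; rewrite ler0_norm; last by rewrite subr_le0.
by rewrite lerNr.
Qed.

Lemma continuation_estimate : exists (C : R) (N : nat), 0 <= C /\
  forall m, cabs (mv_val (sigma (real_row m))) <=
    C * poly_growth m ^+ N * \prod_(i < n) decay (m ord0 i).
Proof.
have [d d0 Hd] := log_item_gap.
have H (L : order) : exists CN : R * nat, 0 <= CN.1 /\ (uniq L -> forall m,
    (forall j, complex.Re (log_ratio L (real_row m) ord0 j) <= - d) ->
    cabs (mv_val (sigma (real_row m))) <=
      CN.1 * poly_growth m ^+ CN.2 * \prod_(i < n) decay (m ord0 i)).
  have [uL|nuL] := boolP (uniq L); last by exists (0, 0%N).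
  by have [C [N [C0 HC]]] := order_estimate uL d0; exists (C, N).
have [CN CNP] := choice H.
(* There are finitely many orders, so summing the constants and taking the largest exponent
   dominates all of them; tuples with repetitions received zero constants. *)
exists (\sum_L (CN L).1), (\max_L (CN L).2)%N; split.
  by apply: sumr_ge0 => L _; exact: (CNP L).1.
move=> m; have [L uL HL] := sorted_order m.
apply: le_trans ((CNP L).2 uL m (HL d (Hd m))) _.
rewrite ler_wpM2r//; first by apply: prodr_ge0 => i _; exact: decay_ge0.
have pg1 := poly_growth_ge1 m.
apply: ler_pM; rewrite ?exprn_ge0 ?(CNP L).1 ?(le_trans ler01)//.
  by rewrite (bigD1 L)//= lerDl sumr_ge0// => L' _; exact: (CNP L').1.
by apply: ler_weXn2l => //; exact: (leq_bigmax (F := fun L => (CN L).2)).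
Qed.

(** Coordinate by coordinate, |u_i|^(m_i) times the decay is (|u_i| |q|)^(m_i) for m_i >= 0 and
    |u_i|^(m_i) otherwise. On a compact subset both are at most theta^|m_i| with one theta < 1,
    which outweighs the polynomial factor. *)
Lemma continuation_converges : converges_absolutely_on_compacta (annuli n tau)
  (fun m (u : 'rV[R[i]]_n) => (\prod_(i < n) u ord0 i ^ m ord0 i)
     * mv_val (sigma (real_row m))).
Proof.
move=> K cK KA; have [theta th01 Hth] := annulus_gap cK KA.
have [C [N [C0 HC]]] := continuation_estimate.
have [eta [C' [eta01 C'0 HC']]] := poly_geometric_le N th01.
exists (fun m => (C * C' ^+ n) * \prod_(i < n) eta ^+ `|m ord0 i|%N).
  by apply: summable_geometric => //; rewrite mulr_ge0// exprn_ge0.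
move=> u m Ku; rewrite cabsM cabs_prod.
apply: le_trans (ler_wpM2l _ (HC m)) _; first by apply: prodr_ge0 => i _; exact: cabs_ge0.
rewrite mulrC -!mulrA ler_wpM2l// -prodrXl -!big_split/=.
have -> : C' ^+ n = \prod_(i < n) C' by rewrite prodr_const card_ord.
rewrite -big_split/=; apply: ler_prod => i _.
rewrite !mulr_ge0 ?exprn_ge0 ?decay_ge0 ?cabs_ge0//=.
apply: le_trans (HC' `|m ord0 i|%N); rewrite ler_wpM2l ?exprn_ge0//.
have [h1 h2] := Hth u i Ku; have /andP[th0 _] := th01.
rewrite cabs_exprz; case: (m ord0 i) => k /=.
  rewrite mulrC -exprMn lerXn2r// nnegrE mulr_ge0// cabs_ge0//.
rewrite mul1r NegzE -exprnN -exprVn lerXn2r// nnegrE// invr_ge0 cabs_ge0//.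
Qed.

End Estimate.

Theorem theorem38 (R : realType) (n : nat) (f : multivalued (M0n R n))
    (tau : R[i]) (t : 'rV[R[i]]_n) (y0 : mv_space f)
    (sigma : 'rV[R]_n -> mv_space f)
    (f_unipotent : unipotent f)
    (t_in_calS : in_calS tau t)
    (y0_over_t : mv_proj y0 = t)
    (sigma_continuation : continuation tau t y0 sigma)
    (f_vanishes : forall I : {set 'I_n}, I != finset.set0 ->
       vanishes_along sigma (divisor_type0 R I) #|I|) :
  converges_absolutely_on_compacta (annuli n tau)
    (fun (m : 'rV[int]_n) (u : 'rV[R[i]]_n) =>
       (\prod_(i < n) u ord0 i ^ m ord0 i)
         * mv_val (sigma (map_mx (fun z : int => z%:~R) m))).
Proof.
(* The estimate needs fixed logarithms of the t_i, which are nonzero because |q| < |t_i|. *)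
have H (i : 'I_n) : exists w, cexp w = t ord0 i.
  apply: cexp_surj; case: t_in_calS => _ /(_ i) /andP[h _] _ _ _.
  by rewrite -cabs_gt0; apply: lt_trans h; rewrite cabs_gt0 cexp_neq0.
have [ell ellP] := choice H.

exact: (@continuation_converges R n f tau t y0 sigma f_unipotent t_in_calS
  sigma_continuation f_vanishes ell ellP).
Qed.
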